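(* Let $\mathcal{X}$ be an admissible class of compact metric spaces. Then there exists a function $M_{\mathcal{X}}:[0,\infty)\times(0,1]\to\mathbb{N}$ with the following property. For every $X\in\mathcal{X}$ and any $*$-representations $\pi:C(X)\to\mathcal{B}(H_\pi)$ and $\rho:C(X)\to\mathcal{B}(H_\rho)$ such that $\pi$ is injective and $\pi(C(X))\cap\mathcal{K}(H_\pi)=\{0\}$, there exists an isometry $V:H_\rho\to H_\pi$ such that for all $L\geq 0$ and $\varepsilon\in(0,1]$ and every $f\in C_L(X)$, the operator $V^*\pi(f)V-\rho(f)$ is within $\varepsilon$ (in operator norm) of an operator of rank at most $M_{\mathcal{X}}(L,\varepsilon)$.
   Context: A class $\mathcal{X}$ of compact metric spaces is called admissible (one also says that the spaces in $\mathcal{X}$ have jointly locally bounded geometry) if for every $\varepsilon>0$ there exists $N\geq 0$ such that every $X\in\mathcal{X}$ has an $\varepsilon$-net of cardinality at most $N$ (i.e. a subset $E\subset X$ with $|E|\le N$ such that every point of $X$ is within distance $\varepsilon$ of $E$). For a metric space $X$ and $L\geq 0$, $C_L(X)=\{f:X\to\mathbb{C}\mid f \text{ is } L\text{-Lipschitz},\ \|f\|_\infty\leq 1\}$, and $C(X)$ is the C*-algebra of continuous complex-valued functions on $X$. $H_\pi$ and $H_\rho$ are Hilbert spaces; $\mathcal{B}(H)$ and $\mathcal{K}(H)$ denote the bounded and the compact operators on a Hilbert space $H$. The function $M_{\mathcal{X}}$ depends only on the class $\mathcal{X}$, and the isometry $V$ does not depend on $L$, $\varepsilon$ or $f$.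
   Formalization: The representation ρ is additionally assumed unital and H_ρ separable; without these the claim fails (ρ = 0 on ℓ² with π unital and f = 1; or X a point, H_π = ℓ² and H_ρ non-separable). *)

(* Defs.v *)
From HB Require Import structures.
From mathcomp Require Import all_boot all_order all_algebra.
From mathcomp Require Import complex.
From mathcomp Require Import all_classical all_reals all_analysis.

Set Implicit Arguments.
Unset Strict Implicit.
Unset Printing Implicit Defensive.

Import Order.TTheory GRing.Theory Num.Theory.
Import numFieldNormedType.Exports.

Local Open Scope classical_set_scope.
Local Open Scope ring_scope.
Local Open Scope complex_scope.

(* Inner products are linear in the first variable. Over R[i] the library norm
   takes values in R[i] (nonnegative reals); Re brings it back to R. *)
HB.mixin Record CompleteNormedModule_isHilbert (R : realType) V
    of CompleteNormedModule R[i] V := {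
  inner : {dot V for (@Num.conj R[i])};
  inner_norm : forall x : V, inner x x = `|x| ^+ 2
}.

#[short(type="hilbertType")]
HB.structure Definition Hilbert (R : realType) :=
  {V of CompleteNormedModule R[i] V & CompleteNormedModule_isHilbert R V}.

Section ContinuousFunctions.
Context (T : topologicalType) (K : numClosedFieldType).

Definition continuous_pred : {pred T -> K^o} := mem [set f | continuous f].

Record cfun := CFun {cfun_val :> T -> K^o; _ : cfun_val \in continuous_pred}.

HB.instance Definition _ := [isSub for cfun_val].
HB.instance Definition _ := [Choice of cfun by <:].

Lemma continuous_subring_closed : subring_closed continuous_pred.
Proof.
split=> [|f g|f g]; rewrite !inE /=.
- by move=> x; apply: (@cvg_cst K^o).
- by move=> cf cg x; apply: (@cvgB K K^o _ _ _ _ _ _ _ (cf x) (cg x)).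
- by move=> cf cg x; apply: (@cvgM K _ _ _ _ _ _ _ (cf x) (cg x)).
Qed.

HB.instance Definition _ := GRing.isSubringClosed.Build (T -> K^o)
  continuous_pred continuous_subring_closed.
HB.instance Definition _ := GRing.SubChoice_isSubComPzRing.Build _ _ cfun
  continuous_subring_closed.

Lemma continuous_scaler_closed : scaler_closed continuous_pred.
Proof.
move=> a f; rewrite !inE /= => cf x.
by apply: (@cvgZr K K^o _ _ _ _ _ _ (cf x)).
Qed.

HB.instance Definition _ := GRing.isScaleClosed.Build K (T -> K^o)
  continuous_pred continuous_scaler_closed.
HB.instance Definition _ := [SubZmodule_isSubLmodule of cfun by <:].

Lemma conj_continuous (f : cfun) :
  (fun x => (f x)^* : K^o)%R \in continuous_pred.
Proof.
rewrite inE /= => x; apply/cvgrPdist_lt => e e0.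
have cf : continuous f by have := valP f; rewrite inE.
have /cvgrPdist_lt/(_ e e0) := cf x.
by apply: filterS => y; rewrite -(rmorphB (@Num.conj K)) norm_conjC.
Qed.

Definition cfun_conj (f : cfun) : cfun := CFun (conj_continuous f).

End ContinuousFunctions.

Section MetricSpaces.
Context (R : realType).

Definition is_net (X : metricType R) (eps : R) (E : set X) :=
  forall x : X, exists2 e, E e & mdist x e <= eps.

Definition admissible (XX : metricType R -> Prop) :=
  forall eps : R, 0 < eps -> exists N : nat, forall X, XX X ->
    exists2 E : set X, (E #<= `I_N)%card & is_net eps E.

Definition lipschitz_ball (X : metricType R) (L : R) : set (cfun X R[i]) :=
  [set f | (forall x y, `|f x - f y| <= (L * mdist x y)%:C) /\
           (forall x, `|f x| <= 1)].

End MetricSpaces.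

Section Operators.
Context (R : realType).
Implicit Types H K : hilbertType R.

Definition bounded_operator H K (A : H -> K) :=
  linear A /\ exists c : R, forall x, `|A x| <= c%:C * `|x|.

Definition opnorm H K (A : H -> K) : R :=
  sup [set complex.Re `|A x| | x in [set x | `|x| <= 1]].

Definition is_adjoint H K (A : H -> K) (B : K -> H) :=
  forall x y, inner (A x) y = inner x (B y).

Definition isometric H K (V : H -> K) :=
  linear V /\ forall x, `|V x| = `|x|.

Definition compact_operator H K (A : H -> K) :=
  bounded_operator A /\ precompact (A @` [set x | `|x| <= 1]).

Definition rank_le H K (A : H -> K) (n : nat) :=
  exists v : 'I_n -> K, forall x,
    exists c : 'I_n -> R[i], A x = \sum_(i < n) c i *: v i.

Definition separable H := exists2 D : set H, countable D & dense D.

(* Not assumed unital: pi 1 is only a projection in general. Voiculescu-type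
   statements need the compressed-to representation rho
   to be unital and on a separable space; pi needs neither. *)
Record star_representation (X : topologicalType) H
    (pi : cfun X R[i] -> H -> H) : Prop := {
  rep_bounded : forall f, bounded_operator (pi f);
  rep_linear : linear pi;
  rep_mul : forall f g, pi (f * g) = pi f \o pi g;
  rep_star : forall f, is_adjoint (pi f) (pi (cfun_conj f))
}.

Definition unital (X : topologicalType) H (pi : cfun X R[i] -> H -> H) :=
  pi 1 = id.

End Operators.

(* Main.v *)
Require Import Defs.
From HB Require Import structures.
From mathcomp Require Import all_boot all_order all_algebra.
From mathcomp Require Import complex.
From mathcomp Require Import all_classical all_reals all_analysis.
From mathcomp Require Import ring lra zify.
Import Order.TTheory GRing.Theory Num.Theory.
Import numFieldNormedType.Exports.
Local Open Scope classical_set_scope.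
Local Open Scope ring_scope.

(** Let N n bound the size of a 2^-n-net of X. Cover X by N n balls around the
    points y_(n,j) of such a net and choose continuous g_(n,j) >= 0 supported
    near y_(n,j) with sum_j g_(n,j)^2 = 1. An L-Lipschitz f is within
    2 * L * 2^-n of its average T_n = sum_j f(y_(n,j)) g_(n,j)^2, so all
    Lipschitz functions are controlled at scale 2^-n by the N n functions
    g_(n,j)^2 alone ([partition_exists], [average_dist]).

    On the side of rho, start from 0 and let the next term of a flag of
    finite-dimensional subspaces be spanned by the previous one, by its images
    under all rho(g_(m,j)) and rho(g_(m,j)^2) with m at most the current level,
    and by one more vector of a dense sequence ([flag_exists]). The dimensions
    depend on N only, and this is what makes the final rank uniform. From level
    n on, rho(T_n) and its adjoint raise the level by at most one, so they are
    block tridiagonal there. A diagonal operator whose weight changes by at most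
    2^-n from one layer of the flag to the next therefore nearly commutes with
    rho(T_n), with error 2 * 2^-n ([diag_commutator]). The weights are taken as
    square roots of differences of long linear ramps; the resulting finite-rank
    diagonal operators D_n satisfy sum_n D_n^2 = 1 ([sum_cut_cvg]).

    On the side of pi, a bump function h at y has a non-compact pi(h), hence
    the range of pi(h) contains unit vectors orthogonal to any given finite
    set, and on such a vector pi(f) is almost multiplication by f(y)
    ([eigensystem]). Choose an orthonormal family u_(n,j,k) with pi(f) u close
    to f(y_(n,j)) u for all Lipschitz f at once, and put
      V x = sum_n V_n x,
      V_n x = sum_(j,k) <rho(g_(n,j)) D_n x, e_k> u_(n,j,k),
    where (e_k) is the orthonormal system adapted to the flag. Then V is
    isometric, because sum_j g_(n,j)^2 = 1 and sum_n D_n^2 = 1 ([rnorm_blk],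
    [V_isometric]), and
      V^* pi(f) V_n ~ D_n rho(T_n) D_n ~ rho(T_n) D_n^2 ~ rho(f) D_n^2,
    with total error at most 3 (L + 1) 2^-n ([rnorm_block_err]). Summing over
    n, V^* pi(f) V - rho(f) is a norm-convergent series of such errors, the
    first n of which vanish off a term of the flag whose dimension depends on
    n and N only ([sum_block_err_rank], [block_err_tail]). The partition of
    unity plays the role of the spectral projections on both sides. *)

Set Implicit Arguments.
Unset Strict Implicit.
Unset Printing Implicit Defensive.
Local Open Scope complex_scope.

(** * Real-valued norms and inner products *)

Section RealNorm.
Context (R : realType).

(** The library norms take values in R[i]; real-valued copies give access to the
    total order and to the tactics for ordered fields. *)
Definition cmod (z : R[i]) : R := complex.Re `|z|.

Lemma cmodE (z : R[i]) : `|z| = (cmod z)%:C.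
Proof. by rewrite /cmod RRe_real// ger0_real. Qed.

Lemma cmod_ge0 z : 0 <= cmod z.
Proof. by rewrite -ler0c -cmodE. Qed.

Lemma cmodM y z : cmod (y * z) = cmod y * cmod z.
Proof. by apply: complexI; rewrite rmorphM /= -!cmodE normrM. Qed.

Lemma ler_cmodD y z : cmod (y + z) <= cmod y + cmod z.
Proof. by rewrite -lecR rmorphD /= -!cmodE ler_normD. Qed.

Lemma cmod_real (a : R) : cmod a%:C = `|a|.
Proof. by apply: complexI; rewrite -cmodE normc_def /= expr0n /= addr0 sqrtr_sqr. Qed.

Lemma cmod_sqr (z : R[i]) : z * z^*%C = (cmod z ^+ 2)%:C.
Proof. by rewrite -sqr_normc cmodE rmorphXn. Qed.

Lemma cmodJ (z : R[i]) : cmod z^*%C = cmod z.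
Proof. by apply: complexI; rewrite -!cmodE normcJ. Qed.

Lemma cmod_le (z : R[i]) (c : R) : (`|z| <= c%:C) = (cmod z <= c).
Proof. by rewrite cmodE lecR. Qed.

Context (H : hilbertType R).
Implicit Types x y z : H.

Definition rnorm (x : H) : R := complex.Re `|x|.

Lemma rnormE x : `|x| = (rnorm x)%:C.
Proof. by rewrite /rnorm RRe_real// ger0_real. Qed.

Lemma rnorm_ge0 x : 0 <= rnorm x.
Proof. by rewrite -ler0c -rnormE. Qed.

Lemma rnorm0 : rnorm 0 = 0.
Proof. by rewrite /rnorm normr0. Qed.

Lemma rnorm_eq0 x : rnorm x = 0 -> x = 0.
Proof. by move=> h; apply/eqP; rewrite -normr_eq0 rnormE h. Qed.

Lemma ler_rnormD x y : rnorm (x + y) <= rnorm x + rnorm y.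
Proof. by rewrite -lecR rmorphD /= -!rnormE ler_normD. Qed.

Lemma rnormN x : rnorm (- x) = rnorm x.
Proof. by rewrite /rnorm normrN. Qed.

Lemma rnorm_distC x y : rnorm (x - y) = rnorm (y - x).
Proof. by rewrite -rnormN opprB. Qed.

Lemma rnormZ a x : rnorm (a *: x) = cmod a * rnorm x.
Proof. by apply: complexI; rewrite rmorphM /= -rnormE -cmodE -rnormE normrZ. Qed.

Lemma ler_rnorm_sum (I : Type) (r : seq I) (P : pred I) (F : I -> H) :
  rnorm (\sum_(i <- r | P i) F i) <= \sum_(i <- r | P i) rnorm (F i).
Proof.
elim/big_ind2: _ => [|x1 x2 y1 y2 h1 h2|//]; first by rewrite rnorm0.
by apply: le_trans (ler_rnormD _ _) _; apply: lerD.
Qed.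

(** An alias whose type R[i] is syntactic, so that rewriting does not have to
    recover it from the bundled sesquilinear form. *)
Definition ip (x y : H) : R[i] := inner x y.
Local Notation "''[' x , y ]" := (ip x y) : ring_scope.

Lemma rnorm_sqr x : '[x, x] = (rnorm x ^+ 2)%:C.
Proof. by rewrite /ip inner_norm rnormE rmorphXn. Qed.

Lemma innerC x y : '[y, x] = '[x, y]^*%C.
Proof. by rewrite /ip (@hermC _ false (@Num.conj R[i]) _ inner) expr0 mul1r. Qed.

Lemma ip_suml (I : Type) (r : seq I) (P : pred I) (F : I -> H) y :
  '[\sum_(i <- r | P i) F i, y] = \sum_(i <- r | P i) '[F i, y].
Proof. exact: linear_sumlz. Qed.

Lemma ip_sumr (I : Type) (r : seq I) (P : pred I) (F : I -> H) y :
  '[y, \sum_(i <- r | P i) F i] = \sum_(i <- r | P i) '[y, F i].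
Proof. exact: linear_sumr. Qed.

Lemma ipDl x y z : '[x + y, z] = '[x, z] + '[y, z].
Proof. exact: linearDl. Qed.
Lemma ipDr x y z : '[z, x + y] = '[z, x] + '[z, y].
Proof. exact: linearDr. Qed.
Lemma ipBl x y z : '[x - y, z] = '[x, z] - '[y, z].
Proof. exact: linearBl. Qed.
Lemma ipBr x y z : '[z, x - y] = '[z, x] - '[z, y].
Proof. exact: linearBr. Qed.
Lemma ip0l x : '[0, x] = 0.
Proof. exact: linear0l. Qed.
Lemma ip0r x : '[x, 0] = 0.
Proof. exact: linear0r. Qed.
Lemma ipZl a x y : '[a *: x, y] = a * '[x, y].
Proof. exact: linearZl_LR. Qed.
Lemma ipZr a x y : '[x, a *: y] = a^*%C * '[x, y].
Proof. exact: linearZr_LR. Qed.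

Lemma inner_ext x y : (forall z, '[x, z] = '[y, z]) -> x = y.
Proof.
move=> h; apply/subr0_eq/rnorm_eq0/eqP; rewrite -sqrf_eq0; apply/eqP/complexI.
by rewrite -rnorm_sqr ipBl h subrr.
Qed.

Lemma rnorm_pythagoras x y : '[x, y] = 0 -> rnorm (x + y) ^+ 2 = rnorm x ^+ 2 + rnorm y ^+ 2.
Proof.
move=> xy0; apply: complexI; rewrite rmorphD /= -!rnorm_sqr ipDl !ipDr xy0.
by rewrite (innerC x y) xy0 conjc0 add0r addr0.
Qed.

Lemma rnorm_sum_orth (I : eqType) (r : seq I) (F : I -> H) : uniq r ->
  (forall i j, i != j -> '[F i, F j] = 0) ->
  rnorm (\sum_(i <- r) F i) ^+ 2 = \sum_(i <- r) rnorm (F i) ^+ 2.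
Proof.
move=> + oF; elim: r => [|i r IH] /=; first by rewrite !big_nil rnorm0 expr0n.
move=> /andP[ir ur]; rewrite !big_cons rnorm_pythagoras ?IH // ip_sumr.
rewrite big_seq big1// => j jr; apply: oF; apply: contraNneq ir => ->//.
Qed.

Lemma CauchySchwarz x y : cmod '[x, y] <= rnorm x * rnorm y.
Proof.
have [y0|y0] := eqVneq (rnorm y) 0.
  by rewrite y0 mulr0 (rnorm_eq0 y0) ip0r (cmod_real 0) normr0.
pose a := '[x, y] / (rnorm y ^+ 2)%:C.
have yy : (rnorm y ^+ 2)%:C != 0 :> R[i].
  by rewrite -(rmorph0 (real_complex R)) (inj_eq (@complexI R)) sqrf_eq0.
(* a *: y is the orthogonal projection of x to the line of y *)
have o : '[x - a *: y, a *: y] = 0.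
  rewrite ipZr ipBl ipZl rnorm_sqr /a divfK // subrr mulr0 //.
have := rnorm_pythagoras o; rewrite subrK => e.
have : rnorm (a *: y) ^+ 2 <= rnorm x ^+ 2 by rewrite e lerDr sqr_ge0.
rewrite ler_sqr ?nnegrE ?rnorm_ge0// rnormZ /a cmodM => le.
have : cmod '[x, y] * rnorm y <= (rnorm x * rnorm y) * rnorm y.
  rewrite -[leRHS]mulrA -expr2.
  have -> : cmod '[x, y] * rnorm y =
      (cmod '[x, y] * cmod (rnorm y ^+ 2)%:C^-1 * rnorm y) * rnorm y ^+ 2.
    rewrite -(fmorphV (real_complex R)) cmod_real ger0_norm ?invr_ge0 ?sqr_ge0//.
    by field.
  by rewrite ler_wpM2r ?sqr_ge0.
by rewrite ler_pM2r // lt_neqAle eq_sym y0 rnorm_ge0.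
Qed.

(** Covers orthogonal projections without mentioning the operator: for
    p = P x the hypothesis is P^* P = P^*. *)
Lemma rnorm_le_ip x p : '[p, p] = '[x, p] -> rnorm p <= rnorm x.
Proof.
move=> e; have := CauchySchwarz x p; rewrite -e rnorm_sqr cmod_real ger0_norm ?sqr_ge0//.
have [->|p0] := eqVneq (rnorm p) 0; first by rewrite rnorm_ge0.
by rewrite expr2 ler_pM2r // lt_neqAle eq_sym p0 rnorm_ge0.
Qed.

(** Norms of adjoints are estimated by duality, through this criterion. *)
Lemma ler_rnorm_inner x c : 0 <= c -> (forall y, cmod '[x, y] <= c * rnorm y) -> rnorm x <= c.
Proof.
move=> c0 /(_ x); rewrite rnorm_sqr cmod_real ger0_norm ?sqr_ge0// expr2 => h.
have [x0|x0] := eqVneq (rnorm x) 0; first by rewrite x0.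
by move: h; rewrite ler_pM2r // lt_neqAle eq_sym x0 rnorm_ge0.
Qed.

End RealNorm.
Local Notation "''[' x , y ]" := (ip x y) : ring_scope.

Section Adjoints.
Context (R : realType).
Implicit Types H K : hilbertType R.

Lemma adjP H K (A : H -> K) (B : K -> H) :
  is_adjoint A B <-> forall x y, '[A x, y] = '[x, B y].
Proof. by []. Qed.

Lemma adjE H K (A : H -> K) (B : K -> H) x y :
  is_adjoint A B -> '[A x, y] = '[x, B y].
Proof. by move=> h; exact: (h x y). Qed.

Lemma adj_linear H K (A : H -> K) (B : K -> H) : is_adjoint A B -> linear A.
Proof.
by move=> /adjP h a x y; apply: inner_ext => z; rewrite h ipDl ipZl -!h -ipZl -ipDl.
Qed.

Lemma adj_sym H K (A : H -> K) (B : K -> H) : is_adjoint A B -> is_adjoint B A.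
Proof. by move=> /adjP h; apply/adjP => x y; rewrite innerC -h -innerC. Qed.

Lemma adj_bound H K (A : H -> K) (B : K -> H) c : 0 <= c -> is_adjoint A B ->
  (forall y, rnorm (B y) <= c * rnorm y) -> forall x, rnorm (A x) <= c * rnorm x.
Proof.
move=> c0 AB Bc x; apply: ler_rnorm_inner; first by rewrite mulr_ge0 ?rnorm_ge0.
move=> y; rewrite (adjE _ _ AB) (le_trans (CauchySchwarz _ _))// -mulrA mulrCA.
by rewrite ler_wpM2l ?rnorm_ge0.
Qed.

(** The definitions of operators carry linearity as a proposition; these are
    the consequences of the library's bundled linear maps in that form. *)
Section Linear.
Context (U V : lmodType R[i]) (A : U -> V) (lA : linear A).
Let A' : {linear U -> V} := HB.pack A (GRing.isLinear.Build _ _ _ _ A lA).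
Lemma linD x y : A (x + y) = A x + A y. Proof. exact: (linearD A'). Qed.
Lemma linB x y : A (x - y) = A x - A y. Proof. exact: (linearB A'). Qed.
Lemma linZ a x : A (a *: x) = a *: A x. Proof. exact: (linearZZ A'). Qed.
Lemma lin0 : A 0 = 0. Proof. exact: (linear0 A'). Qed.
Lemma lin_sum (I : Type) (r : seq I) (P : pred I) (F : I -> U) :
  A (\sum_(i <- r | P i) F i) = \sum_(i <- r | P i) A (F i).
Proof. exact: (linear_sum A'). Qed.
End Linear.

End Adjoints.

(** * Gram-Schmidt flags with prescribed dimensions *)

Section OrthoSystem.
Context (R : realType) (H : hilbertType R).
Implicit Types (x y : H) (e : nat -> H).

(** An orthonormal system in which zero vectors are allowed, so that
    Gram-Schmidt needs no independence and keeps the original indices. *)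
Definition orthosys e := forall i j, '[e i, e j] = ((i == j) && (e i != 0))%:R.

Definition proj e n x := \sum_(k < n) '[x, e k] *: e k.

Lemma orthosys_neq e i j : orthosys e -> i != j -> '[e i, e j] = 0.
Proof. by move=> oe ij; rewrite oe (negbTE ij). Qed.

Lemma orthosys_self e i : orthosys e -> '[e i, e i] *: e i = e i.
Proof.
by move=> oe; rewrite oe eqxx /=; case: eqP => [->|_]; rewrite ?scaler0 ?scale1r.
Qed.

Lemma proj_linear e n : linear (proj e n).
Proof.
move=> a x y; rewrite /proj scaler_sumr -big_split; apply: eq_bigr => k _ /=.
by rewrite ipDl ipZl scalerDl scalerA.
Qed.

Lemma proj_adj e n : is_adjoint (proj e n) (proj e n).
Proof.
apply/adjP => x y; rewrite /proj ip_suml ip_sumr; apply: eq_bigr => k _.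
by rewrite ipZl ipZr -innerC mulrC.
Qed.

Lemma proj_sys e n k : orthosys e -> (k < n)%N -> proj e n (e k) = e k.
Proof.
move=> oe kn; rewrite /proj (bigD1 (Ordinal kn)) //= big1 ?addr0 ?orthosys_self//.
by move=> i ik; rewrite orthosys_neq ?scale0r// eq_sym.
Qed.

Lemma proj_sys_ge e n k : orthosys e -> (n <= k)%N -> proj e n (e k) = 0.
Proof.
move=> oe kn; rewrite /proj big1// => i _; rewrite orthosys_neq ?scale0r//.
by rewrite neq_ltn (leq_trans (ltn_ord i) kn) orbT.
Qed.

Lemma projK e m n x : orthosys e -> proj e m (proj e n x) = proj e (minn m n) x.
Proof.
move=> oe; rewrite {2}/proj (lin_sum (@proj_linear e m)).
under eq_bigr => k _ do rewrite (linZ (@proj_linear e m)).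
have [mn|/ltnW nm] := leqP m n.
  rewrite /proj -(subnKC mn) big_split_ord /= [X in _ + X]big1 ?addr0.
    by apply: eq_bigr => k _; rewrite -/(proj e m _) proj_sys.
  by move=> k _; rewrite -/(proj e m _) proj_sys_ge ?scaler0// leq_addr.
apply: eq_bigr => k _; rewrite proj_sys//; exact: leq_trans nm.
Qed.

Lemma proj_id e n x : orthosys e -> proj e n (proj e n x) = proj e n x.
Proof. by move=> oe; rewrite projK// minnn. Qed.

Lemma rnorm_proj_split e n x : orthosys e ->
  rnorm x ^+ 2 = rnorm (proj e n x) ^+ 2 + rnorm (x - proj e n x) ^+ 2.
Proof.
move=> oe; rewrite -rnorm_pythagoras ?subrKC//.
by rewrite (adjE _ _ (@proj_adj e n)) (linB (@proj_linear e n)) proj_id// subrr ip0r.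
Qed.

Lemma rnorm_proj e n x : orthosys e -> rnorm (proj e n x) <= rnorm x.
Proof.
move=> oe; rewrite -ler_sqr ?nnegrE ?rnorm_ge0// (rnorm_proj_split n x oe).
by rewrite lerDl sqr_ge0.
Qed.

Lemma rnorm_projC e n x : orthosys e -> rnorm (x - proj e n x) <= rnorm x.
Proof.
move=> oe; rewrite -ler_sqr ?nnegrE ?rnorm_ge0// (rnorm_proj_split n x oe).
by rewrite lerDr sqr_ge0.
Qed.

End OrthoSystem.

Section GramSchmidt.
Context (R : realType) (H : hilbertType R) (v : nat -> H).

(** If x lies in the span of s then z = 0 and the new vector is 0, thanks to
    the convention 0^-1 = 0. *)
Definition gs_next (s : seq H) (x : H) : H :=
  let z := x - \sum_(e <- s) '[x, e] *: e in (rnorm z)^-1%:C *: z.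

Fixpoint gs_list n : seq H :=
  if n is m.+1 then rcons (gs_list m) (gs_next (gs_list m) (v m)) else [::].

Definition gs n := gs_next (gs_list n) (v n).

Lemma gs_list_sum (f : H -> H) n : \sum_(e <- gs_list n) f e = \sum_(k < n) f (gs k).
Proof.
elim: n => [|n IH]; first by rewrite big_nil big_ord0.
by rewrite /= -cats1 big_cat big_seq1 /= IH big_ord_recr.
Qed.

Lemma gsE n : gs n = (rnorm (v n - proj gs n (v n)))^-1%:C *: (v n - proj gs n (v n)).
Proof. by rewrite /gs /gs_next gs_list_sum. Qed.

Lemma gs_orthosys : orthosys gs.
Proof.
have self n : '[gs n, gs n] = (gs n != 0)%:R.
  rewrite rnorm_sqr gsE rnormZ; set z := v n - _.
  have [z0|z0] := eqVneq (rnorm z) 0.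
    by rewrite (rnorm_eq0 z0) rnorm0 scaler0 eqxx mulr0 expr0n.
  rewrite cmod_real ger0_norm ?invr_ge0 ?rnorm_ge0// mulVf// expr1n rmorph1.
  case: eqP => // /(congr1 (@rnorm R H)); rewrite rnorm0 rnormZ.
  rewrite cmod_real ger0_norm ?invr_ge0 ?rnorm_ge0// mulVf// => /eqP.
  by rewrite oner_eq0.
have lt n : forall k, (k < n)%N -> '[gs n, gs k] = 0.
  elim/ltn_ind: n => n IH k kn; rewrite gsE ipZl ipBl.
  have -> : '[proj gs n (v n), gs k] = '[v n, gs k]; last by rewrite subrr mulr0.
  rewrite /proj ip_suml (bigD1 (Ordinal kn)) //= big1 ?addr0; last first.
    move=> i ik; rewrite ipZl.
    have [ki|ik'] := ltnP k i; first by rewrite IH ?mulr0.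
    rewrite (innerC (gs k) (gs i)) (IH k kn) ?conjc0 ?mulr0//.
    by rewrite ltn_neqAle ik' andbT.
  rewrite ipZl self; case: eqP => [->|_]; by rewrite ?ip0r ?mul0r ?mulr1.
move=> i j; have [<-|ij] := eqVneq i j; first by rewrite self.
case: (ltngtP i j) ij => // ij _; last exact: lt.
by rewrite innerC lt// conjc0.
Qed.

Lemma proj_gs n i : (i < n)%N -> proj gs n (v i) = v i.
Proof.
move=> i_n; have oe := gs_orthosys.
suff h : proj gs i.+1 (v i) = v i.
  by rewrite -[in LHS]h projK// (minn_idPr _).
rewrite /proj big_ord_recr /= -/(proj gs i (v i)).
have -> : '[v i, gs i] = (rnorm (v i - proj gs i (v i)))%:C.
  have -> : '[v i, gs i] = '[proj gs i (v i), gs i] + '[v i - proj gs i (v i), gs i].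
    by rewrite -ipDl subrKC.
  rewrite (_ : '[proj gs i (v i), gs i] = 0) ?add0r.
    rewrite gsE ipZr rnorm_sqr conjc_real -rmorphM /=; congr (_ %:C).
    have [->|z0] := eqVneq (rnorm (v i - proj gs i (v i))) 0; first by rewrite expr0n mulr0.
    by rewrite expr2 mulKf.
  by rewrite (adjE _ _ (@proj_adj _ _ gs i)) proj_sys_ge// ip0r.
rewrite gsE scalerA -rmorphM /=.
have [z0|z0] := eqVneq (rnorm (v i - proj gs i (v i))) 0.
  by rewrite (rnorm_eq0 z0) scaler0 addr0; apply/eqP; rewrite eq_sym -subr_eq0 (rnorm_eq0 z0).
by rewrite mulfV// rmorph1 scale1r subrKC.
Qed.

(** The converse inclusion to [proj_gs]: each new vector stays in the span of
    the old ones, expressed as an induction principle on subspaces. *)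
Lemma gs_span (Q : H -> Prop) n : Q 0 ->
    (forall a x y, Q x -> Q y -> Q (a *: x + y)) ->
    (forall i, (i < n)%N -> Q (v i)) ->
  forall k, (k < n)%N -> Q (gs k).
Proof.
move=> Q0 QP Qv; elim/ltn_ind => k IH kn.
rewrite gsE -[_ *: _]addr0; apply: (QP) => //.
rewrite addrC -scaleN1r; apply: (QP); last exact: Qv.
rewrite /proj; elim/big_ind: _ => // [x y Qx Qy|i _].
  by rewrite -[x]scale1r; apply: (QP).
by rewrite -[_ *: _]addr0; apply: (QP) => //; apply: (IH) => //; apply: ltn_trans kn.
Qed.

End GramSchmidt.

Section Flag.
Context (R : realType) (H : hilbertType R) (G : eqType) (act : G -> H -> H).
Context (gens : nat -> seq G) (w : nat -> H).
Hypothesis act_linear : forall g, linear (act g).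

(** Dimensions of a flag when level m has N m generators: old vectors, images
    of old vectors, and one new vector. *)
Fixpoint flag_dim (N : nat -> nat) l :=
  if l is m.+1 then (flag_dim N m + (N m * flag_dim N m + 1))%N else 0%N.

Lemma flag_dim_le N l m : (l <= m)%N -> (flag_dim N l <= flag_dim N m)%N.
Proof.
move=> /subnK <-; elim: (m - l)%N => // k IH.
by rewrite addSn /= (leq_trans IH)// leq_addr.
Qed.

Lemma flag_dim_ge N l : (l <= flag_dim N l)%N.
Proof. by elim: l => //= l IH; lia. Qed.

Fixpoint flag_list l : seq H :=
  if l is m.+1 then
    flag_list m ++ [seq act g x | g <- gens m, x <- flag_list m] ++ [:: w m]
  else [::].

Let N l := size (gens l).
(** Each list extends the previous one, so the lists have a common limit. *)
Let v i := nth 0 (flag_list i.+1) i.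

Lemma size_flag_list l : size (flag_list l) = flag_dim N l.
Proof. by elim: l => //= l IH; rewrite !size_cat size_allpairs /= IH. Qed.

Lemma nth_flag_list l m i : (l <= m)%N -> (i < flag_dim N l)%N ->
  nth 0 (flag_list m) i = nth 0 (flag_list l) i.
Proof.
move=> /subnK <- il; elim: (m - l)%N => // k IH.
rewrite addSn /= nth_cat size_flag_list IH.
by rewrite (leq_trans il)// flag_dim_le// leq_addl.
Qed.

Lemma nth_flag_listE l i : (i < flag_dim N l)%N -> nth 0 (flag_list l) i = v i.
Proof.
move=> il; rewrite /v; have [h|/ltnW h] := leqP l i.+1.
  by rewrite (nth_flag_list h).
by rewrite (nth_flag_list h)// flag_dim_ge.
Qed.

(** The dimensions are counts of the vectors listed, independent of what these
    vectors are: this is the source of the uniform rank bound. *)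
Lemma flag_exists : exists e : nat -> H, [/\ orthosys e,
  forall l, proj e (flag_dim N l.+1) (w l) = w l &
  forall l g k, g \in gens l -> (k < flag_dim N l)%N ->
    proj e (flag_dim N l.+1) (act g (e k)) = act g (e k)].
Proof.
exists (gs v).
have inP l x : x \in flag_list l -> proj (gs v) (flag_dim N l) x = x.
  move=> xl; rewrite -(nth_index 0 xl) nth_flag_listE ?proj_gs//;
  by rewrite -size_flag_list index_mem.
split; first exact: gs_orthosys.
- move=> l; by apply: inP => /=; rewrite !mem_cat mem_seq1 eqxx !orbT.
- move=> l g k gl kl.
  pose Q x := proj (gs v) (flag_dim N l.+1) (act g x) = act g x.
  apply: (@gs_span _ _ v Q (flag_dim N l)) => //; rewrite /Q.
  + by rewrite (lin0 (@act_linear g)) (lin0 (@proj_linear _ _ _ _)).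
  + move=> a x y hx hy; rewrite act_linear (@proj_linear _ _ (gs v)) hx hy //.
  + move=> i il; apply: inP => /=; rewrite !mem_cat.
    apply/orP; right; apply/orP; left; apply: allpairs_f => //.
    by rewrite -(nth_flag_listE il) mem_nth// size_flag_list.
Qed.

End Flag.

(** * Slowly varying diagonal operators along a flag *)

Section Diagonal.
Context (R : realType) (H : hilbertType R) (e : nat -> H) (d : nat -> nat).
Hypothesis oe : orthosys e.
Hypothesis d_mono : {homo d : l m / (l <= m)%N}.
Implicit Types (x y : H) (c : nat -> R).

(** The projections onto the terms of the flag spanned by the first d l vectors,
    and onto the orthogonal differences of consecutive terms. *)
Definition flagp l x := proj e (d l) x.
Definition layer l x := flagp l.+1 x - flagp l x.

Lemma flagp_linear l : linear (flagp l). Proof. exact: proj_linear. Qed.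

Lemma flagp_adj l : is_adjoint (flagp l) (flagp l). Proof. exact: proj_adj. Qed.

Lemma flagpK l m x : (l <= m)%N -> flagp l (flagp m x) = flagp l x.
Proof. by move=> lm; rewrite /flagp projK// (minn_idPl _)// d_mono. Qed.

Lemma flagpKr l m x : (l <= m)%N -> flagp m (flagp l x) = flagp l x.
Proof. by move=> lm; rewrite /flagp projK// (minn_idPr _)// d_mono. Qed.

Lemma layer_linear l : linear (layer l).
Proof.
move=> a x y; by rewrite /layer !(flagp_linear _ a) scalerBr !opprD addrACA.
Qed.

Lemma layer_adj l : is_adjoint (layer l) (layer l).
Proof.
by apply/adjP => x y; rewrite /layer ipBl ipBr !(adjE _ _ (@flagp_adj _)).
Qed.

Lemma flagp_layer l m x : (m < l)%N -> flagp l (layer m x) = layer m x.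
Proof. by move=> ml; rewrite /layer (linB (@flagp_linear l)) !flagpKr// ltnW. Qed.

Lemma flagp_inc0 l m x : (l <= m)%N -> flagp l (layer m x) = 0.
Proof.
by move=> lm; rewrite /layer (linB (@flagp_linear l)) !flagpK ?subrr// leqW.
Qed.

Lemma layer_layer l m x : layer l (layer m x) = if l == m then layer m x else 0.
Proof.
rewrite {1}/layer; case: ltngtP => [lm|ml|->].
- by rewrite !flagp_inc0 ?subrr// ltnW.
- by rewrite !flagp_layer ?subrr// ltnW.
- by rewrite flagp_layer// flagp_inc0// subr0.
Qed.

Lemma layer_orth l m x y : l != m -> '[layer l x, layer m y] = 0.
Proof.
by move=> lm; rewrite (adjE _ _ (@layer_adj l)) layer_layer (negbTE lm) ip0r.
Qed.

Lemma rnorm_layer_sqr l x :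
  rnorm (layer l x) ^+ 2 = rnorm (flagp l.+1 x) ^+ 2 - rnorm (flagp l x) ^+ 2.
Proof.
have {1}-> : flagp l.+1 x = flagp l x + layer l x by rewrite subrKC.
rewrite (rnorm_pythagoras (x := flagp l x)) 1?addrAC ?subrr ?add0r//.
by rewrite (adjE _ _ (@flagp_adj l)) flagp_inc0 ?ip0r.
Qed.

Lemma rnorm_layer_le l x : rnorm (layer l x) <= rnorm x.
Proof.
rewrite -ler_sqr ?nnegrE ?rnorm_ge0// rnorm_layer_sqr.
apply: (@le_trans _ _ (rnorm (flagp l.+1 x) ^+ 2)); first by rewrite gerBl sqr_ge0.
by rewrite ler_sqr ?nnegrE ?rnorm_ge0// rnorm_proj.
Qed.

Lemma sum_rnorm_layer b x : \sum_(l < b) rnorm (layer l x) ^+ 2 <= rnorm x ^+ 2.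
Proof.
rewrite -(big_mkord xpredT (fun l => rnorm (layer l x) ^+ 2)).
under eq_bigr do rewrite rnorm_layer_sqr.
rewrite telescope_sumr//.
apply: (@le_trans _ _ (rnorm (flagp b x) ^+ 2)); first by rewrite gerBl sqr_ge0.
by rewrite ler_sqr ?nnegrE ?rnorm_ge0// rnorm_proj.
Qed.

(** The weight of layer l is c l.+1, so that c l is attached to the l-th term of
    the flag in [diag_abel]. *)
Definition diag c b x := \sum_(l < b) (c l.+1)%:C *: layer l x.

Lemma diag_linear c b : linear (diag c b).
Proof.
move=> a x y; rewrite /diag scaler_sumr -big_split; apply: eq_bigr => l _ /=.
by rewrite layer_linear scalerDr !scalerA mulrC.
Qed.

Lemma diag_adj c b : is_adjoint (diag c b) (diag c b).
Proof.
apply/adjP => x y; rewrite /diag ip_suml ip_sumr; apply: eq_bigr => l _.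
by rewrite ipZl ipZr conjc_real (adjE _ _ (@layer_adj l)).
Qed.

Lemma diag_diag c c' b x :
  diag c b (diag c' b x) = diag (fun l => c l * c' l) b x.
Proof.
rewrite {1}/diag; apply: eq_bigr => l _; rewrite /diag (lin_sum (@layer_linear l)).
rewrite (bigD1 l) //= big1 ?addr0.
  by rewrite (linZ (@layer_linear l)) layer_layer eqxx scalerA -rmorphM.
move=> m ml; rewrite (linZ (@layer_linear l)) layer_layer.
by rewrite eq_sym (inj_eq val_inj) (negbTE ml) scaler0.
Qed.

Lemma diag_sum (I : Type) (r : seq I) (c : I -> nat -> R) b x :
  \sum_(i <- r) diag (c i) b x = diag (fun l => \sum_(i <- r) c i l) b x.
Proof.
rewrite /diag exchange_big; apply: eq_bigr => l _.
by rewrite -scaler_suml rmorph_sum.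
Qed.

Lemma diag_widen c b b' x : (b <= b')%N -> (forall l, (b < l)%N -> c l = 0) ->
  diag c b' x = diag c b x.
Proof.
move=> /subnKC <- c0; rewrite /diag big_split_ord /= [X in _ + X]big1 ?addr0//.
by move=> l _; rewrite c0 ?scale0r// ltnS leq_addr.
Qed.

Lemma flagp_diag c b x : flagp b (diag c b x) = diag c b x.
Proof.
rewrite /diag (lin_sum (@flagp_linear b)); apply: eq_bigr => l _.
by rewrite (linZ (@flagp_linear b)) flagp_layer.
Qed.

Lemma diag_flagp c b x : diag c b (flagp b x) = diag c b x.
Proof.
apply: inner_ext => z; rewrite (adjE _ _ (@diag_adj c b)) (adjE _ _ (@flagp_adj b)).
by rewrite flagp_diag -(adjE _ _ (@diag_adj c b)).
Qed.

Lemma rnorm_diag_sqr c b x :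
  rnorm (diag c b x) ^+ 2 = \sum_(l < b) (`|c l.+1| * rnorm (layer l x)) ^+ 2.
Proof.
rewrite /diag rnorm_sum_orth ?index_enum_uniq//.
  by apply: eq_bigr => l _; rewrite rnormZ cmod_real.
by move=> l m lm; rewrite ipZl ipZr layer_orth ?mulr0.
Qed.

Lemma rnorm_diag c b x : (forall l, `|c l| <= 1) -> rnorm (diag c b x) <= rnorm x.
Proof.
move=> c1; rewrite -ler_sqr ?nnegrE ?rnorm_ge0// rnorm_diag_sqr.
apply: le_trans (sum_rnorm_layer b x); apply: ler_sum => l _.
rewrite ler_sqr ?nnegrE ?mulr_ge0 ?rnorm_ge0//.
by rewrite ler_piMl ?rnorm_ge0.
Qed.

(** Summation by parts: this form sees only the increments of the weight, which
    are small, and the commutators of the projections onto the flag. *)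
Lemma diag_abel c b x : d 0 = 0 -> c b = 0 ->
  diag c b x = \sum_(l < b) (c l - c l.+1)%:C *: flagp l x.
Proof.
move=> d0 cb; suff -> : diag c b x =
    \sum_(l < b) (c l - c l.+1)%:C *: flagp l x + (c b)%:C *: flagp b x.
  by rewrite cb scale0r addr0.
elim: b {cb} => [|b IH].
  by rewrite /diag !big_ord0 /flagp d0 /proj big_ord0 scaler0 addr0.
rewrite {1}/diag !big_ord_recr /= -/(diag c b x) IH /layer -!addrA; congr (_ + _).
rewrite scalerBr rmorphB /= scalerBl -!addrA; congr (_ + _).
by rewrite addrC.
Qed.

Section Commutator.
Context (T T' : H -> H) (n : nat).
Hypothesis TT' : is_adjoint T T'.
Hypothesis T1 : forall x, rnorm (T x) <= rnorm x.
Hypothesis Tlev : forall l x, (n <= l)%N -> flagp l.+1 (T (flagp l x)) = T (flagp l x).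

(** As T raises levels by at most one, the part of T leaving the l.+1-st term
    starts in the last layer of this term and ends in the next layer. *)
Lemma flagp_off l x : (n <= l)%N ->
  T (flagp l.+1 x) - flagp l.+1 (T (flagp l.+1 x)) = layer l.+1 (T (layer l x)).
Proof.
move=> nl; have lT := adj_linear TT'.
rewrite {2}/layer (linB lT) (linB (@layer_linear _)) /layer !(Tlev _ (leqW nl)).
have -> : flagp l.+2 (T (flagp l x)) = T (flagp l x) by rewrite -(Tlev x nl) flagpKr.
by rewrite Tlev// subrr subr0.
Qed.

(** The summands run between different pairs of layers, so their images are
    mutually orthogonal and so are the parts of x that they use. The bound is
    thus the largest coefficient, not the sum of the coefficients. *)
Lemma commutator_lower (a : nat -> R) (eps : R) b x : 0 <= eps ->
  (forall l, `|a l| <= eps) -> (forall l, (l <= n)%N -> a l = 0) ->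
  rnorm (\sum_(l < b) (a l)%:C *: (T (flagp l x) - flagp l (T (flagp l x)))) <= eps * rnorm x.
Proof.
move=> eps0 ae a0; case: b => [|b]; first by rewrite big_ord0 rnorm0 mulr_ge0 ?rnorm_ge0.
rewrite big_ord_recl a0// scale0r add0r.
rewrite (eq_bigr (fun l : 'I_b => (a l.+1)%:C *: layer l.+1 (T (layer l x)))); last first.
  move=> l _; have [nl|ln] := leqP n l; first by rewrite flagp_off.
  by rewrite a0 // !scale0r.
rewrite -ler_sqr ?nnegrE ?mulr_ge0 ?rnorm_ge0// rnorm_sum_orth ?index_enum_uniq//; last first.
  by move=> l m lm; rewrite ipZl ipZr layer_orth ?mulr0.
rewrite exprMn; apply: (@le_trans _ _ (eps ^+ 2 * \sum_(l < b) rnorm (layer l x) ^+ 2)).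
  rewrite mulr_sumr; apply: ler_sum => l _; rewrite rnormZ cmod_real -exprMn.
  rewrite ler_sqr ?nnegrE ?mulr_ge0 ?rnorm_ge0//; apply: ler_pM => //; rewrite ?rnorm_ge0//.
  exact: le_trans (rnorm_layer_le _ _) (T1 _).
by rewrite ler_wpM2l ?sqr_ge0// sum_rnorm_layer.
Qed.

End Commutator.

(** The commutator of T with the projection onto a term of the flag is the part
    of T entering the term minus the part leaving it; the former is the adjoint
    of the part of T' leaving it. *)
Lemma diag_commutator (T T' : H -> H) n c eps b x : is_adjoint T T' ->
  (forall x, rnorm (T x) <= rnorm x) -> (forall x, rnorm (T' x) <= rnorm x) ->
  (forall l x, (n <= l)%N -> flagp l.+1 (T (flagp l x)) = T (flagp l x)) ->
  (forall l x, (n <= l)%N -> flagp l.+1 (T' (flagp l x)) = T' (flagp l x)) ->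
  d 0 = 0 -> c b = 0 -> 0 <= eps -> (forall l, `|c l - c l.+1| <= eps) ->
  (forall l, (l <= n)%N -> c l = c l.+1) ->
  rnorm (diag c b (T x) - T (diag c b x)) <= 2 * eps * rnorm x.
Proof.
move=> TT' T1 T1' TP TP' d0 cb eps0 ce c0.
have lT := adj_linear TT'.
pose a l := c l - c l.+1.
have a0 l : (l <= n)%N -> a l = 0 by move=> ln; rewrite /a c0// subrr.
(* the parts of an operator leaving the terms of the flag, and those of T entering them,
   with the increments of the weight as coefficients *)
pose lower (S : H -> H) y := \sum_(l < b) (a l)%:C *: (S (flagp l y) - flagp l (S (flagp l y))).
pose upper y := \sum_(l < b) (a l)%:C *: (flagp l (T y) - flagp l (T (flagp l y))).
have -> : diag c b (T x) - T (diag c b x) = upper x - lower T x.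
  rewrite !diag_abel// (lin_sum lT) -!sumrB; apply: eq_bigr => l _.
  by rewrite (linZ lT) -!scalerBr opprB addrA subrK.
have up_low : is_adjoint upper (lower T').
  apply/adjP => y z; rewrite /upper /lower ip_suml ip_sumr; apply: eq_bigr => l _.
  rewrite ipZl ipZr conjc_real ipBl ipBr; congr (_ * (_ - _)).
    by rewrite (adjE _ _ (@flagp_adj l)) (adjE _ _ TT').
  by rewrite (adjE _ _ (@flagp_adj l)) (adjE _ _ TT') (adjE _ _ (@flagp_adj l)).
have lowb := commutator_lower TT' T1 TP b x eps0 ce a0.
have lowb' y := commutator_lower (adj_sym TT') T1' TP' b y eps0 ce a0.
have upb := adj_bound eps0 up_low lowb' x.
apply: le_trans (ler_rnormD _ _) _; rewrite rnormN mulrAC mulr2n mulrDl mul1r mulrDl.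
by rewrite ![rnorm x * _]mulrC; apply: lerD.
Qed.

(** For a decreasing weight from 1 to 0, the diagonal operator is an average of
    the projections onto the terms of the flag beyond t. *)
Lemma diag_partition_cvg (A : nat -> R) b t x r : d 0 = 0 -> A 0 = 1 -> A b = 0 ->
  (forall l, A l.+1 <= A l) -> (forall l, (l <= t)%N -> A l = 1) ->
  (forall l, (t <= l)%N -> rnorm (flagp l x - x) <= r) ->
  rnorm (diag A b x - x) <= r.
Proof.
move=> d0 A0 Ab Am At xr.
have s1 : \sum_(l < b) (A l - A l.+1) = 1.
  rewrite -(big_mkord xpredT (fun l => A l - A l.+1)).
  under eq_bigr do rewrite -opprB.
  by rewrite sumrN telescope_sumr// A0 Ab sub0r opprK.
rewrite diag_abel// -[X in _ - X]scale1r -[1](rmorph1 (real_complex R)) -s1 rmorph_sum.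
rewrite scaler_suml -sumrB; apply: le_trans (ler_rnorm_sum _ _ _) _.
rewrite -[leRHS]mul1r -s1 mulr_suml; apply: ler_sum => l _.
rewrite -scalerBr rnormZ cmod_real ger0_norm ?subr_ge0//.
have [lt|tl] := ltnP l t; first by rewrite !At ?subrr ?mul0r// ltnW.
by rewrite ler_wpM2l ?subr_ge0// xr.
Qed.

End Diagonal.

(** * Slowly varying weights *)

Section Weights.
Context (R : realType).
Implicit Types n l : nat.

(** Growing geometrically, so that consecutive ramps do not overlap and the
    slope 1 / plateau n is 4^-n / 16. *)
Definition plateau n : nat := (4 ^ n.+2)%N.

Definition ramp n l : R := Num.max 0 (Num.min 1 (2 - l%:R / (plateau n)%:R)).

(** Differences of consecutive ramps telescope to a partition of 1. *)
Definition wgt_sqr n l : R := ramp n l - (if n is m.+1 then ramp m l else 0).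

Definition wgt n l : R := Num.sqrt (wgt_sqr n l).

Let plateau_gt0 n : 0 < (plateau n)%:R :> R.
Proof. by rewrite ltr0n expn_gt0. Qed.

Lemma ramp_ge0 n l : 0 <= ramp n l.
Proof. by rewrite /ramp le_max lexx. Qed.

Lemma ramp_le1 n l : ramp n l <= 1.
Proof. by rewrite /ramp ge_max ler01 ge_min lexx. Qed.

Lemma ramp1 n l : (l <= plateau n)%N -> ramp n l = 1.
Proof.
move=> ln; rewrite /ramp (min_idPl _) ?(max_idPr _)//.
have : l%:R / (plateau n)%:R <= 1 :> R by rewrite ler_pdivrMr// mul1r ler_nat.
lra.
Qed.

Lemma ramp0 n l : ((plateau n).*2 <= l)%N -> ramp n l = 0.
Proof.
move=> ln; rewrite /ramp (max_idPl _)// ge_min; apply/orP; right.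
have : 2 <= l%:R / (plateau n)%:R :> R.
  by rewrite ler_pdivlMr// -natrM ler_nat mul2n.
lra.
Qed.

Lemma ramp_nondecreasing n l : ramp n l <= ramp n.+1 l.
Proof.
rewrite /ramp ge_max le_max lexx /= le_max; apply/orP; right.
rewrite ge_min le_min lexx /=; apply/orP.
have : l%:R / (plateau n.+1)%:R <= l%:R / (plateau n)%:R :> R.
  rewrite ler_wpM2l// lef_pV2 ?posrE// ler_nat leq_pexp2l//.
move=> h; case: (leP 1 (2 - l%:R / (plateau n.+1)%:R : R)) => h1; [by left|right].
by lra.
Qed.

Lemma ramp_lipschitz n l :
  0 <= ramp n l - ramp n l.+1 <= (plateau n)%:R^-1.
Proof.
rewrite /ramp -(natr1 l) mulrDl mul1r.
have : 0 <= l%:R / (plateau n)%:R :> R by rewrite divr_ge0.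
have : 0 < (plateau n)%:R^-1 :> R by rewrite invr_gt0.
set a := _ / _; set h := _^-1 => h0 a0.
case: (leP 1 (2 - a)) => ha; case: (leP 1 (2 - (a + h))) => hb.
- by rewrite !(max_idPr ler01) subrr lexx ltW.
- rewrite (max_idPr ler01); case: (leP 0 (2 - (a + h))) => hc; lra.
- lra.
- by case: (leP 0 (2 - a)) => hc; case: (leP 0 (2 - (a + h))) => hd; lra.
Qed.

Lemma wgt_sqr_ge0 n l : 0 <= wgt_sqr n l.
Proof.
by case: n => [|n]; rewrite /wgt_sqr ?subr0 ?ramp_ge0// subr_ge0 ramp_nondecreasing.
Qed.

Lemma sum_wgt_sqr n l : \sum_(m < n.+1) wgt m l ^+ 2 = ramp n l.
Proof.
elim: n => [|n IH]; rewrite ?big_ord1 ?(big_ord_recr n.+1) ?IH /= sqr_sqrtr ?wgt_sqr_ge0//.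
  by rewrite /wgt_sqr subr0.
by rewrite /wgt_sqr subrKC.
Qed.

Lemma wgt_le1 n l : `|wgt n l| <= 1.
Proof.
rewrite ger0_norm ?sqrtr_ge0// -[leRHS]sqrtr1 ler_wsqrtr// /wgt_sqr.
apply: le_trans (ramp_le1 n l); rewrite gerBl; case: n => // n; exact: ramp_ge0.
Qed.

Lemma wgt0 m n l : (m <= n)%N -> ((plateau n).*2 <= l)%N -> wgt m l = 0.
Proof.
move=> mn nl; have r0 : ramp m l = 0.
  by apply: ramp0; apply: leq_trans nl; rewrite leq_double leq_pexp2l.
apply/eqP; rewrite sqrtr_eq0 /wgt_sqr r0 sub0r oppr_le0.
case: m {mn r0} => // m; exact: ramp_ge0.
Qed.

Lemma wgt_const n l : (l <= n)%N -> wgt n l = wgt n l.+1.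
Proof.
move=> ln; have h m : (m < 4 ^ m)%N by exact: ltn_expl.
have e m : (n <= m.+1)%N -> ramp m l = ramp m l.+1.
  by move=> nm; have := h m.+2; rewrite -/(plateau m) => hm; rewrite !ramp1//; lia.
by rewrite /wgt /wgt_sqr e//; case: n ln e => // n ln e; rewrite e.
Qed.

(** Taking square roots costs a square root in the slope, which is why the ramps
    have slope of order 4^-n and not 2^-n. *)
Lemma ler_sqrt_dist (a b : R) : 0 <= a -> 0 <= b ->
  `|Num.sqrt a - Num.sqrt b| ^+ 2 <= `|a - b|.
Proof.
wlog ab : a b / b <= a => [hw a0 b0|].
  have [|/ltW] := leP b a => h; first exact: hw.
  by rewrite distrC [leRHS]distrC; apply: hw.
move=> a0 b0; have h := ler_wsqrtr ab.
rewrite !ger0_norm ?subr_ge0// -[in leRHS](sqr_sqrtr a0) -[in leRHS](sqr_sqrtr b0).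
have := sqrtr_ge0 b; nra.
Qed.

Lemma wgt_lipschitz n l : `|wgt n l - wgt n l.+1| <= 2 ^- n.
Proof.
rewrite -ler_sqr ?nnegrE ?invr_ge0 ?exprn_ge0//.
apply: le_trans (ler_sqrt_dist (wgt_sqr_ge0 _ _) (wgt_sqr_ge0 _ _)) _.
have -> : (2 ^- n) ^+ 2 = (4 ^+ n)^-1 :> R.
  by rewrite exprVn -exprM mulnC exprM -natrX.
have p m : (plateau m)%:R^-1 = (4 ^+ m)^-1 / 16 :> R.
  by rewrite /plateau natrX !exprS !invfM; field; rewrite expf_neq0.
have g0 : 0 < (4 ^+ n : R)^-1 by rewrite invr_gt0 exprn_gt0.
rewrite /wgt_sqr; case: n g0 => [|n] g0.
  have := ramp_lipschitz 0 l; rewrite !p !subr0 => /andP[? ?].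
  by rewrite ger0_norm//; lra.
have e : (4 ^+ n.+1)^-1 = (4 ^+ n)^-1 / 4 :> R by rewrite exprS invfM mulrC.
have := ramp_lipschitz n.+1 l; have := ramp_lipschitz n l; rewrite !p e.
rewrite e in g0 *; set q := _ ^-1 in g0 *.
move=> /andP[? ?] /andP[? ?].
by rewrite ler_norml; apply/andP; split; lra.
Qed.

End Weights.

(** * Continuous functions and their representations *)

Section ContinuousFunctions.
Context (R : realType) (X : topologicalType).
Implicit Types f g : cfun X R[i].

Lemma cfun_ext f g : f =1 g -> f = g.
Proof. by move=> fg; apply: val_inj; apply/funext. Qed.

Lemma cfunM f g x : (f * g) x = f x * g x. Proof. by []. Qed.
Lemma cfunD f g x : (f + g) x = f x + g x. Proof. by []. Qed.
Lemma cfunB f g x : (f - g) x = f x - g x. Proof. by []. Qed.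
Lemma cfunZ a f x : (a *: f) x = a * f x. Proof. by []. Qed.
Lemma cfun1 x : (1 : cfun X R[i]) x = 1. Proof. by []. Qed.
Lemma cfun0 x : (0 : cfun X R[i]) x = 0. Proof. by []. Qed.
Lemma cfun_sum (I : Type) (r : seq I) (F : I -> cfun X R[i]) x :
  (\sum_(i <- r) F i) x = \sum_(i <- r) F i x.
Proof. by elim/big_rec2: _ => // i y1 y2 _ <-. Qed.
Lemma cfun_conjE f x : cfun_conj f x = (f x)^*%C. Proof. by []. Qed.

Lemma real_continuous (phi : X -> R) : continuous phi ->
  (fun x => (phi x)%:C : R[i]^o) \in @continuous_pred X R[i].
Proof.
move=> cphi; rewrite inE /= => x; apply/cvgrPdist_lt => e e0.
have eE : e = (complex.Re e)%:C by rewrite RRe_real// ger0_real// ltW.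
have e0' : 0 < complex.Re e by rewrite -ltcR -eE.
have /cvgrPdist_lt/(_ _ e0') := cphi x.
apply: filterS => y; rewrite -rmorphB /= eE cmodE cmod_real ltcR//.
Qed.

Definition cfun_of (phi : X -> R) (cphi : continuous phi) : cfun X R[i] :=
  CFun (real_continuous cphi).

Lemma cmod_continuous f : continuous (fun x => cmod (f x)).
Proof.
move=> x; apply/cvgrPdist_lt => e e0.
have cf : continuous f by have := valP f; rewrite inE.
have e0' : 0 < e%:C by rewrite ltcR.
have /cvgrPdist_lt/(_ _ e0') := cf x.
apply: filterS => y; rewrite -ltcR; apply: le_lt_trans.
rewrite -cmod_real -cmodE rmorphB /= -!cmodE; exact: ler_dist_dist.
Qed.

End ContinuousFunctions.

Section Representations.
Context (R : realType) (X : topologicalType) (H : hilbertType R).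
Context (pi : cfun X R[i] -> H -> H) (rep_pi : star_representation pi).
Implicit Types f g : cfun X R[i].

Lemma rep_lin f : linear (pi f).
Proof. by case: (rep_bounded rep_pi f). Qed.

Lemma repM f g v : pi (f * g) v = pi f (pi g v).
Proof. by rewrite (rep_mul rep_pi). Qed.

Let pi_app v f := pi f v.
Let pi_app_lin v : linear (pi_app v).
Proof. by move=> a f g; rewrite /pi_app (rep_linear rep_pi). Qed.

Lemma repD f g v : pi (f + g) v = pi f v + pi g v.
Proof. exact: (linD (pi_app_lin v)). Qed.
Lemma repB f g v : pi (f - g) v = pi f v - pi g v.
Proof. exact: (linB (pi_app_lin v)). Qed.
Lemma repZ a f v : pi (a *: f) v = a *: pi f v.
Proof. exact: (linZ (pi_app_lin v)). Qed.
Lemma rep_sum (I : Type) (r : seq I) (F : I -> cfun X R[i]) v :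
  pi (\sum_(i <- r) F i) v = \sum_(i <- r) pi (F i) v.
Proof. exact: (lin_sum (pi_app_lin v)). Qed.

Lemma rnorm_rep1 v : rnorm (pi 1 v) <= rnorm v.
Proof.
have c1 : cfun_conj (1 : cfun X R[i]) = 1.
  by apply: cfun_ext => x; rewrite cfun_conjE cfun1 conjc1.
by apply: rnorm_le_ip; rewrite (adjE _ _ (rep_star rep_pi 1)) c1 -repM mul1r.
Qed.

(** With k = (c^2 - |f|^2)^(1/2), the identity f^* f + k^2 = c^2 turns into
    |pi(f) v|^2 + |pi(k) v|^2 = c^2 |pi(1) v|^2, and pi(1) is a projection. *)
Lemma rnorm_rep f c v : (forall x, cmod (f x) <= c) -> 0 <= c -> rnorm (pi f v) <= c * rnorm v.
Proof.
move=> fc c0.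
have csqrt : continuous (fun x => Num.sqrt (c ^+ 2 - cmod (f x) ^+ 2)).
  move=> x; apply: continuous_comp; last exact: sqrt_continuous.
  apply: cvgB; first exact: cvg_cst.
  apply: (@continuous_comp _ _ _ (fun y => cmod (f y)) (fun y : R => y ^+ 2)).
    exact: cmod_continuous.
  exact: exprn_continuous.
pose k := cfun_of csqrt.
have ck : cfun_conj k = k by apply: cfun_ext => x; rewrite cfun_conjE conjc_real.
(* f^* f + k^2 = c^2 *)
have sumE : cfun_conj f * f + k * k = (c ^+ 2)%:C *: (1 : cfun X R[i]).
  apply: cfun_ext => x; rewrite cfunD !cfunM cfunZ cfun1 cfun_conjE mulr1.
  rewrite mulrC cmod_sqr /= -rmorphM -rmorphD /= -expr2 sqr_sqrtr ?subrKC//.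
  by rewrite subr_ge0 ler_sqr ?nnegrE ?cmod_ge0.
have adj g : (rnorm (pi g v) ^+ 2)%:C = '[v, pi (cfun_conj g * g) v].
  by rewrite -rnorm_sqr (adjE _ _ (rep_star rep_pi g)) repM.
have : rnorm (pi f v) ^+ 2 + rnorm (pi k v) ^+ 2 = c ^+ 2 * rnorm (pi 1 v) ^+ 2.
  apply: complexI; rewrite rmorphD /= (rmorphM _ (c ^+ 2)) /= !adj -ipDr -repD ck sumE repZ.
  rewrite ipZr conjc_real; congr (_ * '[_, pi _ _]).
  by apply: cfun_ext => x; rewrite cfunM cfun_conjE cfun1 conjc1 mulr1.
move=> e; rewrite -ler_sqr ?nnegrE ?mulr_ge0 ?rnorm_ge0// exprMn.
apply: (@le_trans _ _ (c ^+ 2 * rnorm (pi 1 v) ^+ 2)).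
  by rewrite -e lerDl sqr_ge0.
by rewrite ler_wpM2l ?sqr_ge0// ler_sqr ?nnegrE ?rnorm_ge0// rnorm_rep1.
Qed.

End Representations.

(** * Approximate eigenvectors of a representation without compact operators *)

Section FiniteRankCompact.
Context (R : realType).

Lemma segment_compact (H : hilbertType R) (w : H) (M : R) :
  compact [set t%:C *: w | t in `[(- M)%R, M]%classic].
Proof.
apply: continuous_compact; last exact: segment_compact.
apply: continuous_subspaceT => t; apply/cvgrPdist_lt => e e0.
have eE : e = (complex.Re e)%:C by rewrite RRe_real// ger0_real// ltW.
have e0' : 0 < complex.Re e by rewrite -ltcR -eE.
have d0 : 0 < complex.Re e / (rnorm w + 1).
  by rewrite divr_gt0// (le_lt_trans (rnorm_ge0 w)) ?ltrDl.
have /cvgrPdist_lt/(_ _ d0) : (fun s : R => s) @ t --> t by exact: cvg_id.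
apply: filterS => s /= ts; rewrite -scalerBl -rmorphB /= eE rnormE ltcR rnormZ cmod_real.
apply: (@le_lt_trans _ _ (`|t - s| * (rnorm w + 1))); first by rewrite ler_wpM2l// lerDl.
by rewrite -ltr_pdivlMr ?(le_lt_trans (rnorm_ge0 w)) ?ltrDl.
Qed.

Lemma sumset_compact (H : hilbertType R) (A B : set H) : compact A -> compact B ->
  compact [set p.1 + p.2 | p in A `*` B].
Proof.
move=> cA cB; apply: continuous_compact; last exact: compact_setX.
by apply: continuous_subspaceT => p; exact: add_continuous.
Qed.

(** Bounded real combinations of n vectors form a finite sum of compact
    segments; complex combinations follow by doubling the vectors. *)
Lemma real_span_compact (H : hilbertType R) (M : R) n (w : nat -> H) :
  exists2 K : set H, compact K & forall t : nat -> R,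
    (forall k, `|t k| <= M) -> K (\sum_(k < n) (t k)%:C *: w k).
Proof.
elim: n => [|n [K cK Kt]].
  exists [set 0]; first exact: compact_set1.
  by move=> t _; rewrite big_ord0.
exists [set p.1 + p.2 | p in K `*` [set t%:C *: w n | t in `[(- M)%R, M]%classic]].
  by apply: sumset_compact => //; exact: segment_compact.
move=> t tM; rewrite big_ord_recr /=.
exists (\sum_(k < n) (t k)%:C *: w k, (t n)%:C *: w n) => //.
split => /=; first exact: Kt.
by exists (t n) => //=; rewrite in_itv /= -ler_norml.
Qed.

Lemma finite_rank_compact (H K : hilbertType R) n (a : nat -> H) (b : nat -> K) :
  compact_operator (fun v => \sum_(k < n) '[v, a k] *: b k).
Proof.
split.
  split.
    move=> c x y; rewrite scaler_sumr -big_split; apply: eq_bigr => k _ /=.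
    by rewrite ipDl ipZl scalerDl scalerA.
  exists (\sum_(k < n) rnorm (a k) * rnorm (b k)) => v.
  rewrite !rnormE -rmorphM lecR mulr_suml; apply: le_trans (ler_rnorm_sum _ _ _) _.
  apply: ler_sum => k _; rewrite rnormZ mulrAC ler_wpM2r ?rnorm_ge0// mulrC.
  exact: CauchySchwarz.
pose M := \sum_(k < n) rnorm (a k).
have [K1 cK1 K1P] := real_span_compact M n b.
have [K2 cK2 K2P] := real_span_compact M n (fun k => 'i *: b k).
have cK : compact [set p.1 + p.2 | p in K1 `*` K2] by exact: sumset_compact.
apply: (precompact_subset _ (compact_precompact (@norm_hausdorff _ _) cK)).
move=> _ [v /= + <-]; rewrite rnormE -(rmorph1 (real_complex R)) lecR => v1.
have cM k : (k < n)%N -> cmod '[v, a k] <= M.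
  move=> kn; apply: le_trans (CauchySchwarz _ _) _.
  apply: (@le_trans _ _ (rnorm (a k))); first by rewrite ler_piMl ?rnorm_ge0.
  rewrite /M (bigD1 (Ordinal kn)) //= lerDl sumr_ge0// => i _; exact: rnorm_ge0.
have M0 : 0 <= M by apply: sumr_ge0 => k _; exact: rnorm_ge0.
pose cl (t : nat -> R) k := if (k < n)%N then t k else 0.
pose re := cl (fun k => complex.Re '[v, a k]).
pose im := cl (fun k => complex.Im '[v, a k]).
exists (\sum_(k < n) (re k)%:C *: b k, \sum_(k < n) (im k)%:C *: ('i *: b k)).
  split; [apply: K1P|apply: K2P] => k; rewrite /re /im /cl; case: ifP => [/cM kM|_];
    rewrite ?normr0//; apply: le_trans kM; rewrite -lecR -cmodE.
    exact: normc_ge_Re.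
  have := normc_ge_Re ('[v, a k] * 'i); rewrite ReiNIm normrN normrM.
  rewrite (_ : `|'i%C| = 1) ?mulr1//.
  by rewrite normc_def /= expr0n expr1n add0r sqrtr1.
rewrite /= -big_split; apply: eq_bigr => k _ /=.
rewrite /re /im /cl ltn_ord scalerA -scalerDl; congr (_ *: _).
by rewrite [RHS]complexE mulrC.
Qed.

End FiniteRankCompact.

Section ApproximateEigenvector.
Context (R : realType) (X : metricType R) (H : hilbertType R).
Context (pi : cfun X R[i] -> H -> H) (rep_pi : star_representation pi).
Hypothesis pi_inj : injective pi.
Hypothesis pi_ncpt : range pi `&` [set T | compact_operator T] = [set 0].

Lemma mdist_continuous (y : X) : continuous (mdist y : X -> R).
Proof.
move=> x; apply/cvgrPdist_lt => e e0.
have : nbhs x (ball x e) by exact: nbhsx_ballx.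
rewrite ballEmdist; apply: filterS => z /=; apply: le_lt_trans; rewrite ler_distl.
have := metric_triangle y x z; have := metric_triangle y z x.
rewrite (metric_sym z x); set a := mdist _ _; set b := mdist _ _; set c := mdist _ _.
lra.
Qed.

Lemma bump_continuous (y : X) (r : R) :
  continuous (fun x => Num.max 0 (r - mdist y x)).
Proof.
move=> x; apply: (@continuous_max _ _ (fun=> 0) (fun x => r - mdist y x)).
  exact: cvg_cst.
by apply: cvgB; [exact: cvg_cst|exact: mdist_continuous].
Qed.

Definition bump (y : X) (r : R) : cfun X R[i] := cfun_of (@bump_continuous y r).

(** Otherwise pi(h) vanishes on the orthogonal complement of the finitely many
    vectors pi(h)^* w_k, so pi(h) has finite rank and is compact. *)
Lemma noncompact_range_meets (h : cfun X R[i]) n (w : nat -> H) : h <> 0 ->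
  exists v, pi h v <> 0 /\ forall k, (k < n)%N -> '[pi h v, w k] = 0.
Proof.
move=> h0; apply: contrapT => nex; apply: h0; apply: pi_inj.
have pi0 : pi 0 = 0.
  by apply/funext => v; rewrite -(subrr 0) (repB rep_pi) subrr.
rewrite pi0.
(* pi(h) v is orthogonal to the w_k as soon as v is orthogonal to the pi(h)^* w_k *)
pose e := gs (fun k => pi (cfun_conj h) (w k)).
have oe : orthosys e by exact: gs_orthosys.
have zero v : pi h (v - proj e n v) = 0.
  apply: contrapT => hv; apply: nex; exists (v - proj e n v); split=> // k kn.
  have ek : proj e n (pi (cfun_conj h) (w k)) = pi (cfun_conj h) (w k).
    exact: (proj_gs (fun k => pi (cfun_conj h) (w k)) kn).
  rewrite (adjE _ _ (rep_star rep_pi h)) -ek.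
  by rewrite -(adjE _ _ (@proj_adj _ _ e n)) (linB (@proj_linear _ _ e n)) proj_id// subrr ip0l.
have pihE : pi h = (fun v => \sum_(k < n) '[v, e k] *: pi h (e k)).
  apply/funext => v; have := zero v.
  rewrite (linB (rep_lin rep_pi h)) => /subr0_eq ->.
  rewrite (lin_sum (rep_lin rep_pi h)); apply: eq_bigr => k _.
  by rewrite (linZ (rep_lin rep_pi h)).
have : (range pi `&` [set T | compact_operator T]) (pi h).
  split; first by exists h.
  rewrite /= pihE; exact: (finite_rank_compact n e (fun k => pi h (e k))).
by rewrite pi_ncpt.
Qed.

(** A vector u in the range of pi(h), for a bump h at y, is fixed by pi(k) for
    any k equal to 1 on the support of h; so pi(f) u - f(y) u is the image of u
    under pi((f - f(y)) k), and (f - f(y)) k is small if k is supported near y. *)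
Lemma approx_eigenvector (y : X) (eta : R) n (w : nat -> H) : 0 < eta ->
  exists u, [/\ rnorm u = 1, forall k, (k < n)%N -> '[u, w k] = 0 &
    forall (L : R) (f : cfun X R[i]), 0 <= L ->
      (forall x z, cmod (f x - f z) <= L * mdist x z) ->
      rnorm (pi f u - f y *: u) <= L * eta].
Proof.
move=> eta0; pose r := eta / 2; have r0 : 0 < r by rewrite divr_gt0.
(* h is supported in the ball of radius r, and k below equals 1 there and vanishes
   outside the ball of radius 2 * r = eta *)
pose h := bump y r.
have h0 : h <> 0.
  move=> /(congr1 (fun k : cfun X R[i] => k y)); rewrite cfun0 /= mdistxx subr0.
  rewrite (max_idPr (ltW r0)) => /(@complexI R)/eqP.
  by rewrite gt_eqF.
have [v [hv0 hvw]] := noncompact_range_meets n w h0.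
have nv0 : rnorm (pi h v) != 0 by apply/eqP => /rnorm_eq0.
pose u := (rnorm (pi h v))^-1%:C *: pi h v.
exists u; split.
- by rewrite rnormZ cmod_real ger0_norm ?invr_ge0 ?rnorm_ge0// mulVf.
- by move=> k kn; rewrite ipZl hvw// mulr0.
move=> L f L0 fL.
have ck : continuous (fun x => Num.min 1 (Num.max 0 (2 - r^-1 * mdist y x))).
  move=> x; apply: (@continuous_min _ _ (fun=> 1) (fun x => Num.max 0 (2 - r^-1 * mdist y x))).
    exact: cvg_cst.
  apply: (@continuous_max _ _ (fun=> 0) (fun x => 2 - r^-1 * mdist y x)).
    exact: cvg_cst.
  by apply: cvgB; [exact: cvg_cst|apply: cvgZr; exact: mdist_continuous].
pose k := cfun_of ck.
have ku : pi k u = u.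
  rewrite /u (linZ (rep_lin rep_pi k)) -repM//; congr (_ *: pi _ _).
  apply: cfun_ext => x; rewrite cfunM /=.
  have [rx|xr] := leP r (mdist y x).
    have -> : Num.max 0 (r - mdist y x) = 0 by apply/max_idPl; rewrite subr_le0.
    by rewrite mulr0.
  have : r^-1 * mdist y x <= 1 by rewrite mulrC ler_pdivrMr// mul1r ltW.
  move=> h1; have -> : Num.min 1 (Num.max 0 (2 - r^-1 * mdist y x)) = 1.
    by apply/min_idPl; rewrite le_max; apply/orP; right; lra.
  by rewrite mul1r.
have -> : pi f u - f y *: u = pi (f * k - f y *: k) u.
  by rewrite (repB rep_pi) (repZ rep_pi) (repM rep_pi) ku.
rewrite -[leRHS]mulr1; have <- : rnorm u = 1.
  by rewrite rnormZ cmod_real ger0_norm ?invr_ge0 ?rnorm_ge0// mulVf.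
apply: rnorm_rep => //; last by rewrite mulr_ge0// ltW.
move=> x; rewrite cfunB cfunM cfunZ -mulrBl cmodM /= cmod_real.
have [rx|xr] := leP (2 * r) (mdist y x).
  have : 2 <= r^-1 * mdist y x by rewrite mulrC ler_pdivlMr.
  move=> h2; have -> : Num.max 0 (2 - r^-1 * mdist y x) = 0.
    by apply/max_idPl; rewrite subr_le0.
  rewrite (min_idPr ler01) normr0 mulr0.
  by rewrite mulr_ge0// ltW.
rewrite (le_trans (ler_wpM2r (normr_ge0 _) (fL _ _)))//.
apply: (@le_trans _ _ (L * mdist x y)).
  rewrite ler_piMr ?mulr_ge0 ?mdist_ge0// ger0_norm ?ge_min ?lexx//.
  by rewrite le_min ler01 le_max lexx.
rewrite ler_wpM2l// metric_sym ltW// (lt_le_trans xr)// /r; lra.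
Qed.

Lemma eigensystem (y : nat -> X) (eta : nat -> R) : (forall p, 0 < eta p) ->
  exists u : nat -> H, [/\ orthosys u, (forall p, rnorm (u p) = 1) &
    forall p (L : R) (f : cfun X R[i]), 0 <= L ->
      (forall x z, cmod (f x - f z) <= L * mdist x z) ->
      rnorm (pi f (u p) - f (y p) *: u p) <= L * eta p].
Proof.
move=> eta0.
pose good p (s : seq H) u := [/\ rnorm u = 1, forall k, (k < p)%N -> '[u, nth 0 s k] = 0 &
    forall (L : R) (f : cfun X R[i]), 0 <= L ->
      (forall x z, cmod (f x - f z) <= L * mdist x z) ->
      rnorm (pi f u - f (y p) *: u) <= L * eta p].
have ex p s : exists u, good p s u by exact: approx_eigenvector.
have [next nextP] : {next : nat -> seq H -> H & forall p s, good p s (next p s)}.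
  by exists (fun p s => projT1 (cid (ex p s))) => p s; case: cid.
pose us := fix us p := if p is q.+1 then rcons (us q) (next q (us q)) else [::].
have size_us p : size (us p) = p by elim: p => //= p IH; rewrite size_rcons IH.
pose u p := next p (us p).
have nth_us p k : (k < p)%N -> nth 0 (us p) k = u k.
  elim: p => //= p IH; rewrite nth_rcons size_us ltnS leq_eqVlt.
  by case: ltngtP => //= [kp _|-> _]; rewrite ?IH.
have lt p k : (k < p)%N -> '[u p, u k] = 0.
  by move=> kp; have [_ h _] := nextP p (us p); rewrite -(nth_us p k kp); exact: h.
have u1 p : rnorm (u p) = 1 by case: (nextP p (us p)).
exists u; split => //; last by move=> p; case: (nextP p (us p)).
move=> p q; have [<-|pq] := eqVneq p q.
  rewrite rnorm_sqr u1 expr1n /= (_ : u p != 0)//.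
  by apply: contra_eq_neq (u1 p) => ->; rewrite rnorm0 eq_sym oner_eq0.
case: (ltngtP p q) pq => // pq _; last exact: lt.
by rewrite innerC lt// conjc0.
Qed.

End ApproximateEigenvector.

(** * Partitions of unity subordinate to a net *)

Lemma card_le_enum (T : Type) (x0 : T) (E : set T) (B : set nat) : (E #<= B)%card ->
  exists y : nat -> T, forall x, E x -> exists2 j, B j & y j = x.
Proof.
move=> /pcard_leP[f].
exists (fun j => if pselect (exists2 x, E x & f x = j) is left ex then sval (cid2 ex) else x0).
move=> x Ex; exists (f x); first exact: (@funS _ _ _ _ f x Ex).
case: pselect => [ex|[]]; last by exists x.
case: cid2 => /= x' Ex' xx'; apply: (@inj _ _ _ f) => //; exact/mem_set.
Qed.

Section PartitionOfUnity.
Context (R : realType) (X : metricType R).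

(** The squares sum to 1, and not the functions, because rho(g^2) has to be
    split between the two sides of an inner product. *)
Definition partition_of_unity (delta : R) N (y : nat -> X) (g : nat -> cfun X R[i]) :=
  exists gamma : nat -> X -> R, [/\ forall j x, g j x = (gamma j x)%:C,
    forall x, \sum_(j < N) gamma j x ^+ 2 = 1 &
    forall j x, gamma j x != 0 -> mdist x (y j) <= delta].

Lemma partition_exists (x0 : X) (delta : R) (E : set X) N : 0 < delta ->
  (E #<= `I_N)%card -> is_net delta E ->
  exists y g, partition_of_unity (2 * delta) N y g.
Proof.
move=> delta0 /(card_le_enum x0)[y yE] netE; exists y.
pose phi j x := Num.max 0 (2 * delta - mdist (y j) x).
pose S x := Num.sqrt (\sum_(j < N) phi j x ^+ 2).
have phi_ge0 j x : 0 <= phi j x by rewrite le_max lexx.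
have S2_gt0 x : 0 < \sum_(j < N) phi j x ^+ 2.
  have [e Ee xe] := netE x; have [j jN yj] := yE e Ee.
  rewrite (bigD1 (Ordinal jN)) //= ltr_pwDl ?sumr_ge0// ?exprn_gt0//.
    rewrite lt_max; apply/orP; right; rewrite yj metric_sym.
    by rewrite (lt_le_trans (y := delta))//; lra.
  by move=> i _; rewrite sqr_ge0.
have S_gt0 x : 0 < S x by rewrite sqrtr_gt0.
have cphi j : continuous (phi j) by exact: bump_continuous.
have cS : continuous S.
  move=> x; apply: continuous_comp; last exact: sqrt_continuous.
  apply: cvg_big => [|j _]; first exact: add_continuous.
  apply: (@continuous_comp _ _ _ (phi j) (fun t : R => t ^+ 2)).
    exact: cphi.
  exact: exprn_continuous.
have cgamma j : continuous (fun x => phi j x / S x).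
  by move=> x; apply: cvgM; [exact: cphi|apply: cvgV; [rewrite gt_eqF|exact: cS]].
exists (fun j => cfun_of (cgamma j)), (fun j x => phi j x / S x); split => //.
- move=> x; under eq_bigr do rewrite exprMn.
  by rewrite -mulr_suml exprVn sqr_sqrtr ?ltW// mulfV// gt_eqF.
- move=> j x; rewrite mulf_eq0 negb_or => /andP[+ _].
  rewrite /phi; case: (leP 0 (2 * delta - mdist (y j) x)); rewrite ?eqxx// => h _.
  by rewrite metric_sym -subr_ge0.
Qed.

Section Averages.
Context (delta : R) (N : nat) (y : nat -> X) (g : nat -> cfun X R[i]).
Hypothesis pou : partition_of_unity delta N y g.

(** The replacement of f by a step function, with the squares of the partition
    in the role of the indicators of the cells. *)
Definition average (f : cfun X R[i]) : cfun X R[i] :=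
  \sum_(j < N) f (y j) *: (g j * g j).

Lemma partition_conj j : cfun_conj (g j) = g j.
Proof.
by case: pou => gamma [gE _ _]; apply: cfun_ext => x; rewrite cfun_conjE gE conjc_real.
Qed.

Lemma partition_sum : \sum_(j < N) g j * g j = 1.
Proof.
case: pou => gamma [gE s1 _]; apply: cfun_ext => x; rewrite cfun_sum cfun1.
rewrite -(rmorph1 (real_complex R)) -(s1 x) rmorph_sum; apply: eq_bigr => j _.
by rewrite cfunM gE -rmorphM.
Qed.

Lemma averageE (f : cfun X R[i]) x :
  average f x = \sum_(j < N) f (y j) * (g j x * g j x).
Proof. by rewrite cfun_sum. Qed.

Lemma average_bound (f : cfun X R[i]) c x : (forall z, cmod (f z) <= c) ->
  cmod (average f x) <= c.
Proof.
case: pou => gamma [gE s1 _] fc; rewrite averageE.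
have : cmod (\sum_(j < N) f (y j) * (g j x * g j x)) <= \sum_(j < N) c * gamma j x ^+ 2.
  elim/big_ind2: _ => [|a b a' b' h h'|j _]; first by rewrite (cmod_real 0) normr0.
    by apply: le_trans (ler_cmodD _ _) _; apply: lerD.
  by rewrite gE -rmorphM cmodM cmod_real -expr2 ger0_norm ?sqr_ge0// ler_wpM2r ?sqr_ge0.
by rewrite -mulr_sumr s1 mulr1.
Qed.

Lemma average_dist (f : cfun X R[i]) (L : R) x : 0 <= L ->
  (forall x z, cmod (f x - f z) <= L * mdist x z) ->
  cmod (average f x - f x) <= L * delta.
Proof.
case: pou => gamma [gE s1 near_y] L0 fL.
have -> : average f x - f x = \sum_(j < N) (f (y j) - f x) * (gamma j x ^+ 2)%:C.
  under eq_bigr do rewrite mulrBl.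
  rewrite sumrB -mulr_sumr -rmorph_sum /= s1 mulr1 averageE; congr (_ - _).
  by apply: eq_bigr => j _; rewrite gE -rmorphM.
rewrite -[leRHS]mulr1 -(s1 x) mulr_sumr.
elim/big_ind2: _ => [|a b a' b' h h'|j _]; first by rewrite (cmod_real 0) normr0.
  by apply: le_trans (ler_cmodD _ _) _; apply: lerD.
rewrite cmodM cmod_real ger0_norm ?sqr_ge0//.
have [->|g0] := eqVneq (gamma j x) 0; first by rewrite expr0n !mulr0.
rewrite ler_wpM2r ?sqr_ge0// (le_trans (fL _ _))// ler_wpM2l// metric_sym.
exact: near_y.
Qed.

End Averages.

End PartitionOfUnity.

(** * Orthogonal series of operators *)

Section Convergence.
Context (R : realType) (H : hilbertType R).
Implicit Types (s : nat -> H) (l x : H).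

Definition hcvg s l := forall eps : R, 0 < eps ->
  exists N, forall n, (N <= n)%N -> rnorm (s n - l) <= eps.

Lemma hcvg_cauchy s :
  (forall eps : R, 0 < eps -> exists N, forall n, (N <= n)%N -> rnorm (s n - s N) <= eps) ->
  exists l, hcvg s l.
Proof.
move=> cs; have : cvgn s.
  apply/cauchy_cvgP; apply: cauchy_exP => e e0.
  have eE : e = (complex.Re e)%:C by rewrite RRe_real// ger0_real// ltW.
  have e0' : 0 < complex.Re e by rewrite -ltcR -eE.
  have [|N sN] := cs (complex.Re e / 2); first by rewrite divr_gt0.
  exists (s N), N => // n /= Nn; rewrite -ball_normE /= distrC rnormE eE ltcR.
  by apply: le_lt_trans (sN n Nn) _; rewrite ltr_pdivrMr// ltr_pMr// ltr1n.
move=> /cvgrPdist_le h; exists (limn s) => eps eps0.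
have [|N _ hN] := h eps%:C; first by rewrite ltcR.
by exists N => n /hN /=; rewrite distrC rnormE lecR.
Qed.

(** Bounded sequences with orthogonal increments converge: their squared norms
    increase to a supremum. *)
Lemma hcvg_pythagoras s (C : R) :
  (forall m n, (m <= n)%N -> rnorm (s n - s m) ^+ 2 = rnorm (s n) ^+ 2 - rnorm (s m) ^+ 2) ->
  (forall n, rnorm (s n) <= C) -> exists l, hcvg s l.
Proof.
move=> sp sC; apply: hcvg_cauchy => eps eps0.
pose E := [set rnorm (s n) ^+ 2 | n in setT].
have E_sup : has_sup E.
  split; first by exists (rnorm (s 0%N) ^+ 2), 0%N.
  exists (C ^+ 2) => _ [n _ <-]; rewrite ler_sqr ?nnegrE ?rnorm_ge0//.
  exact: le_trans (rnorm_ge0 _) (sC n).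
have [_ [N _ <-] supN] := @sup_adherent _ E (eps ^+ 2) (exprn_gt0 2 eps0) E_sup.
exists N => n Nn; rewrite -ler_sqr ?nnegrE ?rnorm_ge0 ?(ltW eps0)// sp//.
have : rnorm (s n) ^+ 2 <= sup E by apply: ub_le_sup => //; [case: E_sup|exists n].
lra.
Qed.

Lemma hcvg_le s l x (c : R) : hcvg s l ->
  (exists N, forall n, (N <= n)%N -> rnorm (s n - x) <= c) -> rnorm (l - x) <= c.
Proof.
move=> sl [N sN]; apply/ler_addgt0Pr => eps eps0.
have [M sM] := sl _ eps0.
have -> : l - x = (s (maxn N M) - x) + (l - s (maxn N M)) by rewrite [RHS]addrC addrA subrK.
apply: le_trans (ler_rnormD _ _) _; apply: lerD; first by rewrite sN// leq_maxl.
by rewrite rnorm_distC sM// leq_maxr.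
Qed.

Lemma hcvg_ip s l x : hcvg s l -> forall c,
  (exists N, forall n, (N <= n)%N -> '[s n, x] = c) -> '[l, x] = c.
Proof.
move=> sl c [N sN]; apply: subr0_eq; apply/eqP; rewrite -normr_eq0 cmodE.
suff -> : cmod ('[l, x] - c) = 0 by [].
apply/eqP; rewrite eq_le cmod_ge0 andbT; apply/ler_addgt0Pr => eps eps0; rewrite add0r.
have x1 : 0 < rnorm x + 1 by rewrite ltr_wpDl ?rnorm_ge0.
have [M sM] := sl (eps / (rnorm x + 1)) (divr_gt0 eps0 x1).
rewrite -(sN (maxn N M)) ?leq_maxl// -ipBl; apply: le_trans (CauchySchwarz _ _) _.
rewrite rnorm_distC; apply: (@le_trans _ _ (eps / (rnorm x + 1) * (rnorm x + 1))).
  by apply: ler_pM; rewrite ?rnorm_ge0// ?sM ?leq_maxr// lerDl.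
by rewrite divfK// gt_eqF.
Qed.

End Convergence.

Section OrthogonalSeries.
Context (R : realType) (H K : hilbertType R) (I : eqType) (u : I -> K).
Context (r : nat -> seq I) (a : I -> H).
Hypothesis ou : forall i j, '[u i, u j] = (i == j)%:R.
Hypothesis ur : forall n, uniq (r n).
Hypothesis dr : forall n m i, i \in r n -> i \in r m -> n = m.

Definition block n (x : H) : K := \sum_(i <- r n) '[x, a i] *: u i.
Let block' n (y : K) : H := \sum_(i <- r n) '[y, u i] *: a i.
Let q n (y : K) : K := \sum_(i <- r n) '[y, u i] *: u i.

Hypothesis bessel : forall N x, \sum_(n < N) rnorm (block n x) ^+ 2 <= rnorm x ^+ 2.

Lemma block_adj n : is_adjoint (block n) (block' n).
Proof.
apply/adjP => x y; rewrite /block /block' ip_suml ip_sumr; apply: eq_bigr => i _.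
by rewrite ipZl ipZr -innerC mulrC.
Qed.

Let q_adj n : is_adjoint (q n) (q n).
Proof.
apply/adjP => x y; rewrite /q ip_suml ip_sumr; apply: eq_bigr => i _.
by rewrite ipZl ipZr -innerC mulrC.
Qed.

(** Distinct blocks use disjoint parts of the orthonormal family u. *)
Lemma ip_block n m i (c : I -> R[i]) : i \in r m ->
  '[\sum_(j <- r n) c j *: u j, u i] = if n == m then c i else 0.
Proof.
move=> im; rewrite ip_suml; case: eqP => [->|nm].
  rewrite (bigD1_seq i) //= ipZl ou eqxx mulr1 big1 ?addr0// => j ji.
  by rewrite ipZl ou (negbTE ji) mulr0.
rewrite big_seq big1// => j jn; rewrite ipZl ou; case: eqP => [e|_]; last by rewrite mulr0.
by case: nm; apply: (dr jn); rewrite e.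
Qed.

Lemma ip_blocks n m (c c' : I -> R[i]) : n != m ->
  '[\sum_(j <- r n) c j *: u j, \sum_(j <- r m) c' j *: u j] = 0.
Proof.
move=> nm; rewrite ip_sumr big_seq big1// => i im.
by rewrite ipZr (ip_block n c im) (negbTE nm) mulr0.
Qed.

Lemma rnorm_block n (c : I -> R[i]) :
  rnorm (\sum_(j <- r n) c j *: u j) ^+ 2 = \sum_(j <- r n) cmod (c j) ^+ 2.
Proof.
rewrite rnorm_sum_orth ?ur//; last by move=> i j ij; rewrite ipZl ipZr ou (negbTE ij) !mulr0.
apply: eq_bigr => i _; apply: complexI; rewrite -rnorm_sqr ipZl ipZr ou eqxx mulr1.
by rewrite cmod_sqr.
Qed.

Let block'q n y : block' n (q n y) = block' n y.
Proof.
by rewrite /block' big_seq [RHS]big_seq; apply: eq_bigr => i ir; rewrite (ip_block n _ ir) eqxx.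
Qed.

Let block'q0 n m y : n != m -> block' n (q m y) = 0.
Proof.
move=> nm; rewrite /block' big_seq big1// => i ir.
by rewrite (ip_block m _ ir) eq_sym (negbTE nm) scale0r.
Qed.

Let pyth (v : nat -> K) : (forall n m, n != m -> '[v n, v m] = 0) -> forall m n, (m <= n)%N ->
  rnorm (\sum_(i < n) v i - \sum_(i < m) v i) ^+ 2 =
  rnorm (\sum_(i < n) v i) ^+ 2 - rnorm (\sum_(i < m) v i) ^+ 2.
Proof.
move=> ov m n /subnKC <-; rewrite big_split_ord /=.
set A := \sum_(i < m) v i; set B := \sum_(i < n - m) _.
have AB : '[A, B] = 0.
  rewrite ip_suml big1// => i _; rewrite ip_sumr big1// => j _; apply: ov.
  by rewrite neq_ltn (leq_trans (ltn_ord i))// leq_addr.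
by rewrite (rnorm_pythagoras AB) addrAC subrr add0r addrAC subrr add0r.
Qed.

Lemma rnorm_sum_block N x :
  rnorm (\sum_(n < N) block n x) ^+ 2 = \sum_(n < N) rnorm (block n x) ^+ 2.
Proof.
by rewrite rnorm_sum_orth ?index_enum_uniq// => n m nm; apply: ip_blocks.
Qed.

Let rnorm_sum_block_le N x : rnorm (\sum_(n < N) block n x) <= rnorm x.
Proof. by rewrite -ler_sqr ?nnegrE ?rnorm_ge0// rnorm_sum_block. Qed.

Let rnorm_sum_q N y : rnorm (\sum_(n < N) q n y) <= rnorm y.
Proof.
apply: rnorm_le_ip; rewrite [in RHS]ip_sumr ip_sumr; apply: eq_bigr => n _.
rewrite ip_suml (bigD1 n) //= big1 ?addr0; last by move=> m mn; apply: ip_blocks.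
rewrite (adjE _ _ (@q_adj n)); congr '[_, _].
by rewrite /q big_seq [RHS]big_seq; apply: eq_bigr => i ir; rewrite (ip_block n _ ir) eqxx.
Qed.

(** The blocks have orthogonal ranges, so the series converges by
    [hcvg_pythagoras]. The adjoint series does not have orthogonal terms, but its
    tails are bounded by those of the projections onto the ranges of the blocks. *)
Lemma orthogonal_series : exists (V : H -> K) (Vstar : K -> H), is_adjoint V Vstar /\
  forall x, hcvg (fun N => \sum_(n < N) block n x) (V x).
Proof.
have Vex x : exists l, hcvg (fun N => \sum_(n < N) block n x) l.
  apply: (hcvg_pythagoras (C := rnorm x)); last by move=> n; exact: rnorm_sum_block_le.
  by apply: (pyth (v := fun n => block n x)) => n m; exact: ip_blocks.
have qex y : exists l, hcvg (fun N => \sum_(n < N) q n y) l.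
  apply: (hcvg_pythagoras (C := rnorm y)); last by move=> n; exact: rnorm_sum_q.
  by apply: (pyth (v := fun n => q n y)) => n m; exact: ip_blocks.
have adj N : is_adjoint (fun x => \sum_(n < N) block n x) (fun y => \sum_(n < N) block' n y).
  apply/adjP => x y; rewrite ip_suml ip_sumr; apply: eq_bigr => n _.
  exact: (adjE _ _ (@block_adj n)).
have adj_le N y : rnorm (\sum_(n < N) block' n y) <= rnorm y.
  rewrite -[leRHS]mul1r; apply: (adj_bound ler01 (adj_sym (adj N))) => x.
  by rewrite mul1r rnorm_sum_block_le.
have Wex y : exists l, hcvg (fun N => \sum_(n < N) block' n y) l.
  have [l ql] := qex y; apply: hcvg_cauchy => eps eps0.
  have [|M qM] := ql (eps / 2); first by rewrite divr_gt0.
  exists M => n Mn.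
  (* a tail at y is the full partial sum at the tail of the projections, since
     block' k only sees the k-th projection *)
  have -> : \sum_(k < n) block' k y - \sum_(k < M) block' k y =
      \sum_(k < n) block' k (\sum_(m < n) q m y - \sum_(m < M) q m y).
    have lb k := adj_linear (adj_sym (@block_adj k)).
    have sumq N k : block' k (\sum_(m < N) q m y) = if (k < N)%N then block' k y else 0.
      rewrite (lin_sum (lb k)); case: ifP => [kN|kN].
        rewrite (bigD1 (Ordinal kN)) //= block'q big1 ?addr0// => m mk.
        by rewrite block'q0// eq_sym.
      rewrite big1// => m _; rewrite block'q0//; apply/eqP => e.
      by rewrite e ltn_ord in kN.
    under [RHS]eq_bigr => k _ do rewrite (linB (lb k)) !sumq ltn_ord.
    rewrite sumrB; congr (_ - _); rewrite -(subnKC Mn) big_split_ord /=.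
    rewrite [X in _ + X]big1 ?addr0; last by move=> k _; rewrite ltnNge leq_addr.
    by apply: eq_bigr => k _; rewrite ltn_ord.
  apply: le_trans (adj_le _ _) _.
  rewrite -(subrK l (\sum_(m < n) q m y)) -addrA.
  apply: le_trans (ler_rnormD _ _) _; rewrite [leRHS](splitr eps); apply: lerD.
    exact: qM.
  by rewrite rnorm_distC qM.
pose V x := projT1 (cid (Vex x)); pose Vs y := projT1 (cid (Wex y)).
have VP x : hcvg (fun N => \sum_(n < N) block n x) (V x) by rewrite /V; case: cid.
have WP y : hcvg (fun N => \sum_(n < N) block' n y) (Vs y) by rewrite /Vs; case: cid.
exists V, Vs; split=> //; apply/adjP => x y; apply: subr0_eq; apply/eqP.
rewrite -normr_eq0 cmodE; suff -> : cmod ('[V x, y] - '[x, Vs y]) = 0 by [].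
apply/eqP; rewrite eq_le cmod_ge0 andbT; apply/ler_addgt0Pr => eps eps0; rewrite add0r.
pose c := rnorm x + rnorm y + 1.
have c0 : 0 < c by rewrite /c ltr_wpDl ?addr_ge0 ?rnorm_ge0.
have [M VM] := VP x (eps / c) (divr_gt0 eps0 c0).
have [N WN] := WP y (eps / c) (divr_gt0 eps0 c0).
pose m := maxn M N.
have -> : '[V x, y] - '[x, Vs y] = '[V x - \sum_(n < m) block n x, y]
    + '[x, \sum_(n < m) block' n y - Vs y].
  by rewrite ipBl ipBr (adjE _ _ (adj m)) addrA subrK.
apply: le_trans (ler_cmodD _ _) _.
apply: (@le_trans _ _ (eps / c * rnorm y + eps / c * rnorm x)).
  apply: lerD; apply: le_trans (CauchySchwarz _ _) _.
    by rewrite ler_wpM2r ?rnorm_ge0// rnorm_distC VM// leq_maxl.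
  by rewrite mulrC ler_wpM2r ?rnorm_ge0// WN// leq_maxr.
rewrite -mulrDr mulrAC ler_pdivrMr// ler_pM2l// /c; lra.
Qed.

End OrthogonalSeries.

(** * The isometry and its blocks *)

Section BoundedLimits.
Context (R : realType).

Lemma hcvg_map (H K : hilbertType R) (A : H -> K) (c : R) s l : linear A -> 0 <= c ->
  (forall x, rnorm (A x) <= c * rnorm x) -> hcvg s l -> hcvg (A \o s) (A l).
Proof.
move=> lA c0 Ac sl eps eps0; have c1 : 0 < c + 1 by rewrite ltr_wpDl.
have [N sN] := sl _ (divr_gt0 eps0 c1); exists N => n Nn /=.
rewrite -(linB lA); apply: le_trans (Ac _) _.
apply: (@le_trans _ _ ((c + 1) * (eps / (c + 1)))); last by rewrite mulrC divfK// gt_eqF.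
by apply: ler_pM; rewrite ?rnorm_ge0 ?sN// lerDl.
Qed.

Lemma hcvgB (H : hilbertType R) (s t : nat -> H) l m : hcvg s l -> hcvg t m ->
  hcvg (fun n => s n - t n) (l - m).
Proof.
move=> sl tm eps eps0; have e2 : 0 < eps / 2 by rewrite divr_gt0.
have [N sN] := sl _ e2; have [M tM] := tm _ e2; exists (maxn N M) => n.
rewrite geq_max => /andP[Nn Mn]; have -> : s n - t n - (l - m) = (s n - l) - (t n - m).
  by rewrite !opprD addrACA.
apply: le_trans (ler_rnormD _ _) _; rewrite rnormN [leRHS](splitr eps).
by apply: lerD; [exact: sN|exact: tM].
Qed.

Lemma hcvg_unique (H : hilbertType R) (s : nat -> H) l m :
  hcvg s l -> hcvg s m -> l = m.
Proof.
move=> sl sm; apply: subr0_eq; apply: rnorm_eq0; apply/eqP; rewrite eq_le rnorm_ge0 andbT.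
apply/ler_addgt0Pr => eps eps0; rewrite add0r; apply: (hcvg_le sl); exact: sm.
Qed.

End BoundedLimits.

Section Assembly.
Context (R : realType) (X : metricType R) (H K : hilbertType R).
Context (rho : cfun X R[i] -> H -> H) (pi : cfun X R[i] -> K -> K).
Hypothesis rep_rho : star_representation rho.
Hypothesis rep_pi : star_representation pi.
Hypothesis unital_rho : unital rho.

Context (N : nat -> nat) (y : nat -> nat -> X) (g : nat -> nat -> cfun X R[i]).
Hypothesis pou : forall n, partition_of_unity (2 * 2 ^- n) (N n) (y n) (g n).

Definition gen_count l := sumn [seq (N m + N m)%N | m <- iota 0 l.+1].

(** The functions g_(m,j) keep the vectors rho(g_(m,j)) D_m x inside the flag,
    the squares make rho of an average raise levels by at most one. *)
Definition gens l : seq (cfun X R[i]) := flatten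
  [seq [seq g m j | j <- iota 0 (N m)] ++ [seq g m j * g m j | j <- iota 0 (N m)]
  | m <- iota 0 l.+1].

Lemma size_gens l : size (gens l) = gen_count l.
Proof.
rewrite size_flatten /shape -map_comp; congr sumn; apply: eq_map => m /=.
by rewrite size_cat !size_map size_iota.
Qed.

Lemma gens_partition m j l : (m <= l)%N -> (j < N m)%N ->
  g m j \in gens l /\ g m j * g m j \in gens l.
Proof.
move=> ml jN; have mi : m \in iota 0 l.+1 by rewrite mem_iota ltnS.
have ji : j \in iota 0 (N m) by rewrite mem_iota.
split; apply/flatten_mapP; exists m; rewrite // mem_cat; apply/orP.
  by left; exact: (map_f (g m)).
by right; exact: (map_f (fun j => g m j * g m j)).
Qed.

Definition dims := flag_dim gen_count.

Context (e : nat -> H).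
Hypothesis oe : orthosys e.
Hypothesis e_gens : forall l (h : cfun X R[i]) k, h \in gens l -> (k < dims l)%N ->
  proj e (dims l.+1) (rho h (e k)) = rho h (e k).
Hypothesis e_total : forall x, hcvg (fun l => proj e (dims l) x) x.

Local Notation flagp := (flagp e dims).
Local Notation top n := (plateau n).*2.

Let dims_mono : {homo dims : l m / (l <= m)%N}.
Proof. by move=> l m; exact: flag_dim_le. Qed.

Lemma flagp_gens l h x : h \in gens l -> flagp l.+1 (rho h (flagp l x)) = rho h (flagp l x).
Proof.
move=> hl; rewrite /flagp -[proj e (dims l) x]/(\sum_(k < dims l) '[x, e k] *: e k).
rewrite (lin_sum (rep_lin rep_rho h)).
rewrite (lin_sum (@proj_linear _ _ _ _)); apply: eq_bigr => k _.
by rewrite (linZ (rep_lin rep_rho h)) (linZ (@proj_linear _ _ _ _)) e_gens.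
Qed.

(** The case z j = f (y n j) is the average of f, and the conjugate values of z
    give its adjoint. *)
Lemma flagp_combination l n (z : nat -> R[i]) x : (n <= l)%N ->
  let T := rho (\sum_(j < N n) z j *: (g n j * g n j)) in
  flagp l.+1 (T (flagp l x)) = T (flagp l x).
Proof.
move=> nl T; rewrite /T (rep_sum rep_rho) (lin_sum (@flagp_linear _ _ _ _ _)).
apply: eq_bigr => j _; rewrite (repZ rep_rho) (linZ (@flagp_linear _ _ _ _ _)) flagp_gens//.
by have [] := gens_partition nl (ltn_ord j).
Qed.

(** The operator D_n of the partition sum_n D_n^2 = 1. *)
Definition cut n : H -> H := diag e dims (@wgt R n) (top n).

Lemma cut_adj n : is_adjoint (cut n) (cut n). Proof. exact: diag_adj. Qed.
Lemma cut_linear n : linear (cut n). Proof. exact: diag_linear. Qed.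
Lemma rnorm_cut n x : rnorm (cut n x) <= rnorm x.
Proof. by apply: rnorm_diag => // l; exact: wgt_le1. Qed.

Lemma flagp_cut n x : flagp (top n) (cut n x) = cut n x.
Proof. exact: flagp_diag. Qed.

Lemma cut_flagp n m x : (n <= m)%N -> cut n (flagp (top m) x) = cut n x.
Proof.
move=> nm; rewrite /cut -[in RHS](diag_flagp oe dims_mono) -[in LHS](diag_flagp oe dims_mono).
by rewrite flagpK// leq_double leq_pexp2l.
Qed.

Lemma le_plateau n : (n <= plateau n)%N.
Proof. by rewrite ltnW// ltnW// ltnW// ltn_expl. Qed.

Lemma le_top n : (n <= top n)%N.
Proof. by rewrite -addnn (leq_trans (le_plateau n))// leq_addl. Qed.

(** The squared weights telescope to a single ramp. *)
Lemma sum_cut n x : \sum_(m < n.+1) cut m (cut m x) = diag e dims (@ramp R n) (top n) x.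
Proof.
transitivity (\sum_(m < n.+1) diag e dims (fun l => wgt R m l * wgt R m l) (top n) x).
  apply: eq_bigr => m _; rewrite /cut diag_diag//; apply/esym/diag_widen.
    by rewrite leq_double leq_pexp2l// !ltnS -ltnS ltn_ord.
  by move=> l ml; rewrite (wgt0 R (leqnn m)) ?mulr0// ltnW.
rewrite (diag_sum e dims (index_enum _) (fun (m : 'I_n.+1) l => wgt R m l * wgt R m l)).
congr (diag _ _ _ _ _); apply/funext => l.
by rewrite -sum_wgt_sqr; apply: eq_bigr => m _; rewrite expr2.
Qed.

Lemma sum_cut_cvg x : hcvg (fun n => \sum_(m < n) cut m (cut m x)) x.
Proof.
move=> eps eps0; have [t tx] := e_total x eps0; exists t.+1 => -[//|n] tn.
rewrite sum_cut; apply: (diag_partition_cvg (t := plateau n)) => //.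
- by rewrite ramp1.
- by rewrite ramp0.
- by move=> l; have /andP[+ _] := ramp_lipschitz R n l; rewrite subr_ge0.
- by move=> l; exact: ramp1.
- move=> l pl; apply: tx; apply: leq_trans pl; apply: (leq_trans _ (le_plateau n)).
  by rewrite -ltnS.
Qed.

Lemma cut_bessel n x : \sum_(m < n) rnorm (cut m x) ^+ 2 <= rnorm x ^+ 2.
Proof.
case: n => [|n]; first by rewrite big_ord0 sqr_ge0.
have h : (\sum_(m < n.+1) rnorm (cut m x) ^+ 2)%:C =
    '[diag e dims (@ramp R n) (top n) x, x].
  rewrite -sum_cut ip_suml rmorph_sum; apply: eq_bigr => m _.
  by rewrite (adjE _ _ (@cut_adj m)) rnorm_sqr.
have : cmod '[diag e dims (@ramp R n) (top n) x, x] <= rnorm x * rnorm x.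
  apply: le_trans (CauchySchwarz _ _) _; rewrite ler_wpM2r ?rnorm_ge0//.
  by apply: rnorm_diag => // l; rewrite ger0_norm ?ramp_ge0 ?ramp_le1.
by rewrite -h cmod_real -expr2; apply: le_trans; exact: ler_norm.
Qed.

(** The vector paired with u_(n,j,k): the inner product with it is
    <rho(g_(n,j)) D_n x, e_k>, see [ip_frame]. *)
Definition frame (i : nat * nat * nat) : H := cut i.1.1 (rho (g i.1.1 i.1.2) (e i.2)).

Definition block_index n : seq (nat * nat * nat) :=
  [seq (n, j, k) | j <- index_iota 0 (N n), k <- index_iota 0 (dims (top n).+1)].

Lemma uniq_block_index n : uniq (block_index n).
Proof. by apply: allpairs_uniq; rewrite ?iota_uniq// => -[j k] [j' k'] _ _ [-> ->]. Qed.

Lemma block_index_fst n i : i \in block_index n -> i.1.1 = n.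
Proof. by move=> /allpairsP[[j k] [_ _ ->]]. Qed.

Lemma ip_frame n j k x :
  '[x, frame (n, j, k)] = '[rho (g n j) (cut n x), e k].
Proof.
rewrite /frame /= -(adjE _ _ (@cut_adj n)).
by rewrite (adjE _ _ (rep_star rep_rho (g n j))) (partition_conj (pou n)).
Qed.

(** Parseval for the system e in the finite-dimensional range of
    rho(g_(n,j)) D_n, summed over j: the matrix of a block with weights z is
    D_n rho(sum_j z_j g_(n,j)^2) D_n. *)
Lemma sum_frame n (z : nat -> R[i]) x w :
  \sum_(i <- block_index n) z i.1.2 * '[x, frame i] * '[w, frame i]^*%C =
  '[rho (\sum_(j < N n) z j *: (g n j * g n j)) (cut n x), cut n w].
Proof.
rewrite /block_index big_allpairs_dep (rep_sum rep_rho) ip_suml.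
rewrite big_mkord; apply: eq_bigr => j _ /=.
rewrite (repZ rep_rho) ipZl (repM rep_rho) (adjE _ _ (rep_star rep_rho _)).
rewrite (partition_conj (pou n)).
have <- : flagp (top n).+1 (rho (g n j) (cut n x)) = rho (g n j) (cut n x).
  rewrite -flagp_cut flagp_gens//.
  by have [] := gens_partition (le_top n) (ltn_ord j).
rewrite /flagp /proj ip_suml mulr_sumr.
rewrite -(big_mkord xpredT (fun k => z j *
  '[ '[rho (g n j) (cut n x), e k] *: e k, rho (g n j) (cut n w)])).
apply: eq_bigr => k _.
by rewrite !ip_frame ipZl -innerC mulrA.
Qed.

Context (u : nat * nat * nat -> K) (eta : nat * nat * nat -> R).
Hypothesis ou : forall i j, '[u i, u j] = (i == j)%:R.
Hypothesis u_eigen : forall i (L : R) (f : cfun X R[i]), 0 <= L ->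
  (forall x z, cmod (f x - f z) <= L * mdist x z) ->
  rnorm (pi f (u i) - f (y i.1.1 i.1.2) *: u i) <= L * eta i.
Hypothesis eta_small : forall n (i : nat * nat * nat), i \in block_index n ->
  eta i <= 2 ^- n / (size (block_index n)).+1%:R.

Local Notation blk := (block u block_index frame).

Lemma block_index_disjoint n m i : i \in block_index n -> i \in block_index m -> n = m.
Proof. by move=> /block_index_fst <- /block_index_fst <-. Qed.

Lemma rho_one n v : rho (\sum_(j < N n) (1 : R[i]) *: (g n j * g n j)) v = v.
Proof.
under eq_bigr do rewrite scale1r.
by rewrite (partition_sum (pou n)) unital_rho.
Qed.

(** [sum_frame] for z = 1, as the squares of the partition sum to 1 and rho is
    unital. *)
Lemma rnorm_blk n x : rnorm (blk n x) = rnorm (cut n x).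
Proof.
apply/eqP; rewrite -(eqrXn2 (n := 2)) ?rnorm_ge0//; apply/eqP/complexI.
rewrite /block rnorm_block; [|exact: ou|exact: uniq_block_index].
rewrite rmorph_sum -rnorm_sqr -[X in '[X, _]](rho_one n).
rewrite -(sum_frame n (fun=> 1)); apply: eq_bigr => i _.
by rewrite mul1r cmod_sqr.
Qed.

Lemma blk_bessel n x : \sum_(m < n) rnorm (blk m x) ^+ 2 <= rnorm x ^+ 2.
Proof. by under eq_bigr do rewrite rnorm_blk; exact: cut_bessel. Qed.

Lemma ip_frame_le n i x : i \in block_index n -> cmod '[x, frame i] <= rnorm x.
Proof.
move=> ir; rewrite -ler_sqr ?nnegrE ?rnorm_ge0 ?cmod_ge0//.
apply: (@le_trans _ _ (rnorm (blk n x) ^+ 2)); last first.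
  by rewrite rnorm_blk ler_sqr ?nnegrE ?rnorm_ge0// rnorm_cut.
rewrite /block rnorm_block; [|exact: ou|exact: uniq_block_index].
rewrite (bigD1_seq i) ?uniq_block_index//= lerDl sumr_ge0// => j _; exact: sqr_ge0.
Qed.

Context (V : H -> K) (Vstar : K -> H).
Hypothesis V_adj : is_adjoint V Vstar.
Hypothesis V_cvg : forall x, hcvg (fun n => \sum_(m < n) blk m x) (V x).

Lemma ip_V n i x : i \in block_index n -> '[V x, u i] = '[x, frame i].
Proof.
move=> ir; apply: (hcvg_ip (V_cvg x)); exists n.+1 => m nm.
rewrite ip_suml (bigD1 (Ordinal nm)) //= big1 ?addr0.
  by rewrite (ip_block ou uniq_block_index block_index_disjoint n _ ir) eqxx.
move=> k kn; rewrite (ip_block ou uniq_block_index block_index_disjoint k _ ir).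
by rewrite ifN//; apply: contra kn => /eqP kn; apply/eqP/val_inj.
Qed.

(** Other blocks are orthogonal to the n-th one, so V^* acts on its range as the
    adjoint of the n-th block. *)
Lemma Vstar_weighted n (z : nat -> R[i]) x :
  Vstar (\sum_(i <- block_index n) (z i.1.2 * '[x, frame i]) *: u i) =
  cut n (rho (\sum_(j < N n) z j *: (g n j * g n j)) (cut n x)).
Proof.
apply: inner_ext => w; rewrite (adjE _ _ (adj_sym V_adj)) (adjE _ _ (@cut_adj n)).
rewrite -sum_frame ip_suml big_seq [RHS]big_seq; apply: eq_bigr => i ir.
by rewrite ipZl (innerC (V w) (u i)) (ip_V _ ir).
Qed.

Lemma Vstar_blk n x : Vstar (blk n x) = cut n (cut n x).
Proof.
rewrite /block; under eq_bigr do rewrite -[ip _ _]mul1r.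
by rewrite (Vstar_weighted n (fun=> 1)) rho_one.
Qed.

Lemma rnorm_V_le x : rnorm (V x) <= rnorm x.
Proof.
rewrite -[V x]subr0; apply: (hcvg_le (V_cvg x)); exists 0%N => n _; rewrite subr0.
rewrite -ler_sqr ?nnegrE ?rnorm_ge0// rnorm_sum_block; [exact: blk_bessel|exact: ou|..].
  exact: uniq_block_index.
exact: block_index_disjoint.
Qed.

Lemma rnorm_Vstar_le z : rnorm (Vstar z) <= rnorm z.
Proof.
rewrite -[leRHS]mul1r; apply: (adj_bound ler01 (adj_sym V_adj)) => x.
by rewrite mul1r rnorm_V_le.
Qed.

Lemma VstarK x : Vstar (V x) = x.
Proof.
have lW := adj_linear (adj_sym V_adj).
apply: (hcvg_unique _ (sum_cut_cvg x)).
have : hcvg (Vstar \o (fun n => \sum_(m < n) blk m x)) (Vstar (V x)).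
  by apply: (hcvg_map lW ler01) => // z; rewrite mul1r rnorm_Vstar_le.
congr (hcvg _ _); apply/funext => n /=; rewrite (lin_sum lW).
by apply: eq_bigr => m _; rewrite Vstar_blk.
Qed.

Lemma V_isometric : isometric V.
Proof.
split=> [|x]; first exact: adj_linear V_adj.
rewrite !rnormE; congr (_ %:C); apply/eqP; rewrite -(eqrXn2 (n := 2)) ?rnorm_ge0//.
by apply/eqP/complexI; rewrite -!rnorm_sqr (adjE _ _ V_adj) VstarK.
Qed.

Section Lipschitz.
Context (L : R) (f : cfun X R[i]).
Hypothesis L0 : 0 <= L.
Hypothesis fL : forall x z, cmod (f x - f z) <= L * mdist x z.
Hypothesis f1 : forall x, cmod (f x) <= 1.

(** The n-th term of V^* pi(f) V - rho(f) after inserting V = sum_n V_n and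
    1 = sum_n D_n^2. *)
Definition block_err n x := Vstar (pi f (blk n x)) - rho f (cut n (cut n x)).

Lemma block_err_linear n : linear (block_err n).
Proof.
move=> c x z; rewrite /block_err (adj_linear (@block_adj _ _ _ _ u block_index frame n)).
rewrite (rep_lin rep_pi) (adj_linear (adj_sym V_adj)) !(cut_linear n) (rep_lin rep_rho).
by rewrite scalerBr opprD addrACA.
Qed.

(** The eigenvector errors within a block add up in norm; the tolerance of each
    is divided by the size of the block for this purpose. *)
Lemma blk_eigen n x :
  rnorm (pi f (blk n x) - \sum_(i <- block_index n) (f (y n i.1.2) * '[x, frame i]) *: u i)
  <= L * 2 ^- n * rnorm x.
Proof.
rewrite /block (lin_sum (rep_lin rep_pi f)) -sumrB.
apply: le_trans (ler_rnorm_sum _ _ _) _.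
pose s : R := (size (block_index n)).+1%:R.
have s0 : 0 < s by rewrite ltr0n.
apply: (@le_trans _ _ (\sum_(i <- block_index n) L * 2 ^- n * rnorm x / s)).
  rewrite big_seq [leRHS]big_seq; apply: ler_sum => i ir.
  have -> : pi f ('[x, frame i] *: u i) - (f (y n i.1.2) * '[x, frame i]) *: u i =
      '[x, frame i] *: (pi f (u i) - f (y i.1.1 i.1.2) *: u i).
    by rewrite (linZ (rep_lin rep_pi f)) scalerBr scalerA (block_index_fst ir) mulrC.
  rewrite rnormZ; apply: le_trans (ler_pM (cmod_ge0 _) (rnorm_ge0 _)
    (ip_frame_le _ ir) (u_eigen _ L0 fL)) _.
  rewrite mulrC [leRHS]mulrAC ler_wpM2r ?rnorm_ge0// -mulrA ler_wpM2l//.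
  exact: eta_small.
rewrite big_const_seq count_predT iter_addr_0; set Q := L * _ * rnorm x.
have Q0 : 0 <= Q by rewrite !mulr_ge0 ?rnorm_ge0// invr_ge0 exprn_ge0.
rewrite -[_ *+ _]mulr_natr mulrAC ler_pdivrMr// ler_wpM2l// /s ler_nat; exact: leqnSn.
Qed.

Lemma rnorm_block_err n x : rnorm (block_err n x) <= 3 * (L + 1) * 2 ^- n * rnorm x.
Proof.
pose T := average (N n) (y n) (g n) f.
have lW := adj_linear (adj_sym V_adj).
pose b1 := \sum_(i <- block_index n) (f (y n i.1.2) * '[x, frame i]) *: u i.
have -> : block_err n x = Vstar (pi f (blk n x) - b1)
    + (cut n (rho T (cut n x)) - rho T (cut n (cut n x)))
    + rho (T - f) (cut n (cut n x)).
  have Vb1 : Vstar b1 = cut n (rho T (cut n x)).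
    exact: (Vstar_weighted n (fun j => f (y n j))).
  rewrite (linB lW) Vb1 (repB rep_rho) /block_err.
  by rewrite !addrA !subrK.
have h1 : rnorm (Vstar (pi f (blk n x) - b1)) <= L * 2 ^- n * rnorm x.
  exact: le_trans (rnorm_Vstar_le _) (blk_eigen n x).
have T1 z : cmod (T z) <= 1 by exact: (average_bound (pou n)).
(* the commutator of D_n with rho(T), applied to D_n x *)
have h2 : rnorm (cut n (rho T (cut n x)) - rho T (cut n (cut n x))) <= 2 * 2 ^- n * rnorm x.
  have Tc : cfun_conj T = \sum_(j < N n) (f (y n j))^*%C *: (g n j * g n j).
    apply: cfun_ext => z; rewrite cfun_conjE averageE cfun_sum rmorph_sum.
    apply: eq_bigr => j _; rewrite cfunZ cfunM !rmorphM /=.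
    have gz := congr1 (fun h : cfun X R[i] => h z) (partition_conj (pou n) j).
    by congr (_ * (_ * _)); exact: gz.
  apply: (@le_trans _ _ (2 * 2 ^- n * rnorm (cut n x))); last first.
    by rewrite ler_wpM2l ?rnorm_cut// mulr_ge0// invr_ge0 exprn_ge0.
  apply: (diag_commutator oe dims_mono (T' := rho (cfun_conj T)) (n := n)).
  - exact: (rep_star rep_rho).
  - by move=> z; rewrite -[leRHS]mul1r; apply: (rnorm_rep rep_rho).
  - move=> z; rewrite -[leRHS]mul1r; apply: (rnorm_rep rep_rho) => // t.
    by rewrite cfun_conjE cmodJ.
  - by move=> l z nl; exact: (flagp_combination (fun j => f (y n j))).
  - by move=> l z nl; rewrite Tc; exact: (flagp_combination (fun j => (f (y n j))^*%C)).
  - by [].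
  - by apply: (wgt0 R (leqnn n)).
  - by rewrite invr_ge0 exprn_ge0.
  - by move=> l; exact: wgt_lipschitz.
  - by move=> l; exact: wgt_const.
have h3 : rnorm (rho (T - f) (cut n (cut n x))) <= L * (2 * 2 ^- n) * rnorm x.
  apply: (@le_trans _ _ (L * (2 * 2 ^- n) * rnorm (cut n (cut n x)))).
    apply: (rnorm_rep rep_rho).
      by move=> z; rewrite cfunB; exact: (average_dist (pou n)).
    by rewrite !mulr_ge0// invr_ge0 exprn_ge0.
  rewrite ler_wpM2l ?(le_trans (rnorm_cut _ _)) ?rnorm_cut//.
  by rewrite !mulr_ge0// invr_ge0 exprn_ge0.
apply: le_trans (ler_rnormD _ _) _; apply: le_trans (lerD (ler_rnormD _ _) (lexx _)) _.
apply: le_trans (lerD (lerD h1 h2) h3) _.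
have : 0 <= 2 ^- n * rnorm x by rewrite mulr_ge0 ?rnorm_ge0// invr_ge0 exprn_ge0.
set q := 2 ^- n; set t := rnorm x => qt.
have -> : L * q * t + 2 * q * t + L * (2 * q) * t = (3 * L + 2) * (q * t) by ring.
have -> : 3 * (L + 1) * q * t = (3 * L + 3) * (q * t) by ring.
by rewrite ler_wpM2r// lerD2l ler_nat.
Qed.

Lemma block_err_cvg x : hcvg (fun n => \sum_(m < n) block_err m x) (Vstar (pi f (V x)) - rho f x).
Proof.
have lW := adj_linear (adj_sym V_adj).
have -> : (fun n => \sum_(m < n) block_err m x) = (fun n =>
    (Vstar \o pi f \o (fun n => \sum_(m < n) blk m x)) n
    - (rho f \o (fun n => \sum_(m < n) cut m (cut m x))) n).
  apply/funext => n /=; rewrite (lin_sum (rep_lin rep_pi f)) (lin_sum lW).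
  by rewrite (lin_sum (rep_lin rep_rho f)) -sumrB.
apply: hcvgB.
  apply: (hcvg_map (A := Vstar \o pi f) _ ler01) => [c z w|z|] /=.
  - by rewrite (rep_lin rep_pi) lW.
  - by apply: le_trans (rnorm_Vstar_le _) _; apply: (rnorm_rep rep_pi).
  - exact: V_cvg.
apply: (hcvg_map _ ler01) (sum_cut_cvg x) => [|z]; first exact: (rep_lin rep_rho).
exact: (rnorm_rep rep_rho).
Qed.

(** The first m errors factor through one and the same term of the flag, so the
    rank of their sum is bounded by its dimension and not by a sum. *)
Lemma block_err_flagp n m x : (n <= m)%N -> block_err n (flagp (top m) x) = block_err n x.
Proof.
move=> nm; rewrite /block_err cut_flagp//; congr (Vstar (pi f _) - _).
rewrite /block big_seq [RHS]big_seq; apply: eq_bigr => -[[n' j] k] ir.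
by move: (block_index_fst ir) => /= ->; rewrite !ip_frame cut_flagp.
Qed.

Lemma sum_block_err_rank n : rank_le (fun x => \sum_(m < n) block_err m x) (dims (top n)).
Proof.
exists (fun k => \sum_(m < n) block_err m (e k)) => x; exists (fun k => '[x, e k]).
under eq_bigr => m _ do rewrite -(block_err_flagp x (ltnW (ltn_ord m))).
under [RHS]eq_bigr do rewrite scaler_sumr.
rewrite exchange_big; apply: eq_bigr => m _ /=.
rewrite /flagp /proj (lin_sum (@block_err_linear m)); apply: eq_bigr => k _.
by rewrite (linZ (@block_err_linear m)).
Qed.

Lemma sum_block_err_bounded n : bounded_operator (fun x => \sum_(m < n) block_err m x).
Proof.
split.
  by move=> c x z; rewrite scaler_sumr -big_split; apply: eq_bigr => m _; exact: block_err_linear.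
exists (\sum_(m < n) 3 * (L + 1) * 2 ^- m) => x.
rewrite !rnormE -rmorphM lecR mulr_suml; apply: le_trans (ler_rnorm_sum _ _ _) _.
by apply: ler_sum => m _; exact: rnorm_block_err.
Qed.

Lemma block_err_tail n x :
  rnorm (Vstar (pi f (V x)) - rho f x - \sum_(m < n) block_err m x) <=
    6 * (L + 1) * 2 ^- n * rnorm x.
Proof.
apply: (hcvg_le (block_err_cvg x)); exists n => k /subnKC <-.
rewrite big_split_ord /= addrAC subrr add0r; apply: le_trans (ler_rnorm_sum _ _ _) _.
have c0 : 0 <= L + 1 by rewrite addr_ge0.
suff : \sum_(i < k - n) rnorm (block_err (n + i) x) <=
    6 * (L + 1) * (2 ^- n - 2 ^- (n + (k - n))) * rnorm x.
  move=> /le_trans; apply; rewrite ler_wpM2r ?rnorm_ge0// ler_wpM2l ?mulr_ge0//.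
  by rewrite gerBl invr_ge0 exprn_ge0.
elim: (k - n)%N => [|m IH]; first by rewrite big_ord0 addn0 subrr mulr0 mul0r.
rewrite big_ord_recr /=; apply: le_trans (lerD IH (rnorm_block_err _ _)) _.
rewrite -mulrDl ler_wpM2r ?rnorm_ge0// addnS exprS invfM; set q := 2 ^- (n + m).
by rewrite le_eqVlt; apply/orP; left; apply/eqP; field.
Qed.

End Lipschitz.

End Assembly.

(** * The quantitative theorem *)

Section Main.
Context (R : realType).

Lemma dense_sequence (H : hilbertType R) : separable H ->
  exists w : nat -> H, forall x (eps : R), 0 < eps -> exists i, rnorm (x - w i) <= eps.
Proof.
move=> [D cD dD]; have [w wD] := card_le_enum (0 : H) cD; exists w => x eps eps0.
have e0 : 0 < eps%:C by rewrite ltcR.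
have [||z [/= xz Dz]] := dD (ball x eps%:C); first by exists x; exact: ballxx.
  exact: ball_open.
have [i _ wi] := wD z Dz; exists i; rewrite wi ltW//.
by move: xz; rewrite -ball_normE /= rnormE ltcR.
Qed.

(** Absorbing a dense sequence makes the projections onto the flag converge
    strongly to the identity. *)
Lemma exhausting_flag (H : hilbertType R) (G : eqType) (act : G -> H -> H)
    (gens : nat -> seq G) : separable H -> (forall h, linear (act h)) ->
  exists e : nat -> H, [/\ orthosys e,
    forall l h k, h \in gens l -> (k < flag_dim (size \o gens) l)%N ->
      proj e (flag_dim (size \o gens) l.+1) (act h (e k)) = act h (e k) &
    forall x, hcvg (fun l => proj e (flag_dim (size \o gens) l) x) x].
Proof.
move=> /dense_sequence[w wx] act_lin.
have [e [oe ew e_gens]] := flag_exists gens w act_lin; exists e; split => //.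
move=> x eps eps0; have [i xi] := wx x eps eps0; exists i.+1 => l il.
have wl : proj e (flag_dim (size \o gens) l) (w i) = w i.
  rewrite -[in LHS](ew i) projK// (minn_idPr _)//; exact: flag_dim_le.
rewrite rnorm_distC; apply: le_trans xi.
have -> : x - proj e (flag_dim (size \o gens) l) x =
    (x - w i) - proj e (flag_dim (size \o gens) l) (x - w i).
  by rewrite (linB (@proj_linear _ _ _ _)) wl opprB addrA subrK.
exact: rnorm_projC.
Qed.

(** Number of blocks moved into the finite-rank part. *)
Definition rank_cutoff (L eps : R) : nat := Num.bound (6 * (L + 1) / eps).

Lemma rank_cutoffP (L eps : R) : 0 <= L -> 0 < eps ->
  6 * (L + 1) * 2 ^- rank_cutoff L eps <= eps.
Proof.
move=> L0 eps0; rewrite ler_pdivrMr ?exprn_gt0// [leRHS]mulrC -ler_pdivrMr//.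
have /archi_boundP : 0 <= 6 * (L + 1) / eps by rewrite divr_ge0 ?mulr_ge0 ?addr_ge0// ltW.
move=> /ltW /le_trans; apply; rewrite -natrX ler_nat ltnW//; exact: ltn_expl.
Qed.

Lemma opnorm_le (H K : hilbertType R) (A : H -> K) (c : R) : 0 <= c ->
  (forall x, rnorm (A x) <= c * rnorm x) -> opnorm A <= c.
Proof.
move=> c0 Ac; apply: ge_sup; first by exists (complex.Re `|A 0|), 0; rewrite //= normr0.
move=> _ [x /= x1 <-]; apply: le_trans (Ac x) _.
by rewrite ler_piMr// -lecR -rnormE.
Qed.

Lemma quantitative_voiculescu (X : metricType R) (Hpi Hrho : hilbertType R)
    (pi : cfun X R[i] -> Hpi -> Hpi) (rho : cfun X R[i] -> Hrho -> Hrho)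
    (N : nat -> nat) (x0 : X) :
  (forall n, exists2 E : set X, (E #<= `I_(N n))%card & is_net (2 ^- n) E) ->
  star_representation pi -> star_representation rho -> unital rho -> separable Hrho ->
  injective pi -> range pi `&` [set T | compact_operator T] = [set 0] ->
  exists (V : Hrho -> Hpi) (Vstar : Hpi -> Hrho),
    isometric V /\ is_adjoint V Vstar /\
    forall L eps : R, 0 <= L -> 0 < eps ->
    forall f : cfun X R[i], lipschitz_ball L f ->
    exists F : Hrho -> Hrho,
      bounded_operator F /\
      rank_le F (dims N (plateau (rank_cutoff L eps)).*2) /\
      opnorm ((Vstar \o pi f \o V - rho f) - F) <= eps.
Proof.
move=> nets rep_pi rep_rho unital_rho sep pi_inj pi_ncpt.
have pou_ex n : exists yg : (nat -> X) * (nat -> cfun X R[i]),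
    partition_of_unity (2 * 2 ^- n) (N n) yg.1 yg.2.
  have [E EN netE] := nets n.
  have [|y [g yg]] := partition_exists x0 _ EN netE; last by exists (y, g).
  by rewrite invr_gt0 exprn_gt0.
pose y n := (projT1 (cid (pou_ex n))).1; pose g n := (projT1 (cid (pou_ex n))).2.
have pou n : partition_of_unity (2 * 2 ^- n) (N n) (y n) (g n).
  by rewrite /y /g; case: cid.
have [e [oe e_gens e_total]] := exhausting_flag (gens N g) sep (rep_lin rep_rho).
have dimsE : flag_dim (size \o gens N g) = dims N.
  by rewrite /dims; congr flag_dim; apply/funext => l; exact: size_gens.
rewrite dimsE in e_gens e_total.
(* eigensystem is indexed by nat, the blocks by triples *)
pose dec p := odflt (0, 0, 0)%N (unpickle p : option (nat * nat * nat)).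
have decK (i : nat * nat * nat) : dec (pickle i) = i by rewrite /dec pickleK.
pose eta (i : nat * nat * nat) : R := 2 ^- i.1.1 / (size (block_index N i.1.1)).+1%:R.
have [|u [ou u1 u_eigen]] := eigensystem rep_pi pi_inj pi_ncpt
    (fun p => y (dec p).1.1 (dec p).1.2) (eta := eta \o dec).
  by move=> p; rewrite divr_gt0// invr_gt0 exprn_gt0.
pose v (i : nat * nat * nat) := u (pickle i).
have ov i j : '[v i, v j] = (i == j)%:R.
  rewrite /v ou (inj_eq (pcan_inj pickleK)); case: eqP => //= _.
  rewrite (_ : u _ != 0)//; apply: contra_eq_neq (u1 (pickle i)) => ->.
  by rewrite rnorm0 eq_sym oner_eq0.
have v_eigen i (L : R) (f : cfun X R[i]) : 0 <= L ->
    (forall x z, cmod (f x - f z) <= L * mdist x z) ->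
    rnorm (pi f (v i) - f (y i.1.1 i.1.2) *: v i) <= L * eta i.
  by move=> L0 fL; have := u_eigen (pickle i) L f L0 fL; rewrite /= decK.
have eta_small n (i : nat * nat * nat) : i \in block_index N n ->
    eta i <= 2 ^- n / (size (block_index N n)).+1%:R.
  by move=> ir; rewrite /eta (block_index_fst ir).
have bessel := blk_bessel rep_rho unital_rho pou oe e_gens ov.
have [V [Vstar [V_adj V_cvg]]] :=
  orthogonal_series ov (uniq_block_index N) (@block_index_disjoint N) bessel.
exists V, Vstar; split.
  exact: (V_isometric rep_rho unital_rho pou oe e_gens e_total ov V_adj V_cvg).
split=> // L eps L0 eps0 f [fL f1].
have fL' x z : cmod (f x - f z) <= L * mdist x z by rewrite -cmod_le; exact: fL.
have f1' x : cmod (f x) <= 1 by rewrite -cmod_le; exact: f1.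
pose n := rank_cutoff L eps.
exists (fun x => \sum_(m < n) block_err rho pi N g e v Vstar f m x); split; last split.
- exact: (sum_block_err_bounded rep_rho rep_pi unital_rho pou oe e_gens ov v_eigen
    eta_small V_adj V_cvg L0 fL' f1').
- exact: (sum_block_err_rank rep_rho rep_pi pou oe v V_adj).
apply: opnorm_le; first exact: ltW.
move=> x; apply: le_trans (ler_wpM2r (rnorm_ge0 x) (rank_cutoffP L0 eps0)).
exact: (block_err_tail rep_rho rep_pi unital_rho pou oe e_gens e_total ov v_eigen
    eta_small V_adj V_cvg L0 fL' f1').
Qed.

(** Partitions of unity require a base point; over the empty space 1 = 0 in the
    algebra of functions, and a unital representation lives on 0. *)
Lemma trivial_representation (X : metricType R) (H : hilbertType R)
    (rho : cfun X R[i] -> H -> H) : star_representation rho -> unital rho ->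
  (X -> False) -> forall v : H, v = 0.
Proof.
move=> rep_rho unital_rho X0 v; have one0 : (1 : cfun X R[i]) = 0.
  by apply: cfun_ext => x; case: (X0 x).
by rewrite -[v]/(id v) -unital_rho one0 -(subrr 0) (repB rep_rho) subrr.
Qed.

End Main.


Theorem theorem2p5 (R : realType) (XX : metricType R -> Prop)
    (XX_compact : forall X, XX X -> compact [set: X])
    (XX_admissible : admissible XX) :
  exists M : R -> R -> nat,
  forall X : metricType R, XX X ->
  forall (Hpi Hrho : hilbertType R)
    (pi : cfun X R[i] -> Hpi -> Hpi) (rho : cfun X R[i] -> Hrho -> Hrho),
  star_representation pi ->
  star_representation rho ->
  unital rho ->
  separable Hrho ->
  injective pi ->
  range pi `&` [set T | compact_operator T] = [set 0] ->
  exists (V : Hrho -> Hpi) (Vstar : Hpi -> Hrho),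
    isometric V /\ is_adjoint V Vstar /\
    forall L eps : R, 0 <= L -> 0 < eps <= 1 ->
    forall f : cfun X R[i], lipschitz_ball L f ->
    exists F : Hrho -> Hrho,
      bounded_operator F /\ rank_le F (M L eps) /\
      opnorm ((Vstar \o pi f \o V - rho f) - F) <= eps.
Proof.
have N_ex n : exists N, forall X, XX X ->
    exists2 E : set X, (E #<= `I_N)%card & is_net (2 ^- n) E.
  by apply: XX_admissible; rewrite invr_gt0 exprn_gt0.
pose N n := projT1 (cid (N_ex n)).
have NP n X : XX X -> exists2 E : set X, (E #<= `I_(N n))%card & is_net (2 ^- n) E.
  by rewrite /N; case: cid => /= N' h; exact: h.
exists (fun L eps => dims N (plateau (rank_cutoff L eps)).*2).
move=> X XXX Hpi Hrho pi rho rep_pi rep_rho unital_rho sep pi_inj pi_ncpt.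
have [[x0 _]|X0] := pselect (exists x : X, True).
  have [V [Vstar [V_iso [V_adj VF]]]] := quantitative_voiculescu x0 (fun n => NP n X XXX)
    rep_pi rep_rho unital_rho sep pi_inj pi_ncpt.
  exists V, Vstar; split=> //; split=> // L eps L0 /andP[eps0 _]; exact: VF.
have H0 : forall v : Hrho, v = 0.
  by apply: (trivial_representation rep_rho unital_rho) => x; apply: X0; exists x.
have adj : is_adjoint (fun _ : Hrho => 0 : Hpi) (fun _ : Hpi => 0 : Hrho).
  by apply/adjP => x z; rewrite ip0l ip0r.
have zero_lin : linear (fun _ : Hrho => 0 : Hpi) by exact: adj_linear adj.
exists (fun=> 0), (fun=> 0); split; first by split=> // x; rewrite (H0 x) !normr0.
split=> // L eps L0 /andP[eps0 _] f _; exists (fun=> 0); split; last split.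
- split; first by move=> a x z; rewrite scaler0 addr0.
  by exists 0 => x; rewrite normr0 rmorph0 mul0r.
- by exists (fun=> 0) => x; exists (fun=> 0); rewrite big1// => i _; rewrite scaler0.
apply: opnorm_le; first exact: ltW.
by move=> x; rewrite [X in rnorm X]H0 rnorm0 mulr_ge0 ?rnorm_ge0// ltW.
Qed.
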